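(* Consider the Perrin sequence defined by $$P_0=3,\quad P_1=0,\quad P_2=2,\qquad P_{n+3}=P_{n+1}+P_n\quad\text{for } n\ge 0.$$ Let $p$ be a prime such that $p\nmid 2\cdot 3\cdot 23$. The following assertions are equivalent: \begin{enumerate} \item $P_{p+1}\equiv 2\pmod p$. \item $p=X^2+23Y^2$ for some $X,Y\in\mathbb{Z}$. \item $\left(\frac{-23}{p}\right)=1$ and $x^3-x-1\equiv 0\pmod p$ has a solution in $\mathbb{Z}/p\mathbb{Z}$. \end{enumerate}
   Context: $\left(\frac{\cdot}{p}\right)$ is the Legendre symbol. *)

(* Defs.v *)
From mathcomp Require Import all_boot all_order all_algebra.

Set Implicit Arguments.
Unset Strict Implicit.
Unset Printing Implicit Defensive.

Import GRing.Theory.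

Fixpoint perrin (n : nat) : nat :=
  match n with
  | 0 => 3
  | 1 => 0
  | 2 => 2
  | (m.+1 as m1).+2 => perrin m1 + perrin m
  end.

Local Open Scope ring_scope.

(* The Legendre symbol (a / p); meaningful only for p an odd prime (for other
   p, the type 'F_p is the prime field of the least prime factor of p). *)
Definition legendre (a : int) (p : nat) : int :=
  if (p%:Z %| a)%Z then 0
  else if [exists x : 'F_p, x ^+ 2 == a%:~R] then 1
  else -1.

(* Main.v *)
Require Import Defs.
From mathcomp Require Import all_boot all_order all_algebra.
From mathcomp Require Import closed_field finfield algC.
From mathcomp Require Import zify ring.

(* Write w for a primitive cube root of unity and c = 1 + 2w, so c^2 = -3.

   (1) <-> (3): P_n is the power sum x^n + y^n + z^n of the roots of t^3 - t - 1,
   so P_(p+1) = x x^p + y y^p + z z^p is governed by the permutation that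
   Frobenius induces on the roots: it equals x^2 + y^2 + z^2 = 2 for the identity
   and xy + yz + zx = -1 for a 3-cycle, and for a transposition it can equal 2
   only if 3 is a root modulo p, i.e. p = 23.  The parity of the permutation is
   (-23/p), as -23 is the discriminant.

   (2) <-> (3): if -23 is a square modulo p, reduction of binary quadratic forms
   gives p = X^2 + 23 Y^2 or p = 2 x^2 + x y + 3 y^2; in the second case
   8 p = X^2 + 23 y^2 with X = 4 x + y.  By Cardano's formula t^3 - t - 1 has a
   root modulo p iff (9 + c s) / 18, with s^2 = -23, is a cube in F_(p^2).
   Taking s = X / Y, this is the cubic residue character modulo p of the
   Eisenstein integer z = X - 3 c Y, or z = 25 Y + 3 c X if 3 | X (up to a factor
   2 in the second case).  Cubic reciprocity, proved with Gauss sums in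
   characteristic l, turns it into the character of p modulo z.  As p = - 4 Y^2
   modulo z up to cubes, it is trivial for the first form; for the second one a
   factor 2 survives, which is not a cubic residue of z. *)

Set Implicit Arguments.
Unset Strict Implicit.
Unset Printing Implicit Defensive.

Import Order.TTheory GRing.Theory Num.Theory.
Local Open Scope ring_scope.

(** * Cube roots of unity, Frobenius powers and power sums in finite fields *)

Lemma omega_cube (R : comNzRingType) (w : R) : w ^+ 2 = - w - 1 -> w ^+ 3 = 1.
Proof. by move=> w2; ring: w2. Qed.

Lemma omega_sqr (R : comNzRingType) (w : R) :
  w ^+ 2 = - w - 1 -> (w ^+ 2) ^+ 2 = - w ^+ 2 - 1.
Proof. by move=> w2; ring: w2. Qed.

Lemma omega_prim (R : idomainType) (w : R) :
  w ^+ 2 = - w - 1 -> 3%:R != 0 :> R -> 3.-primitive_root w.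
Proof.
move=> w2 n3; have w3 := omega_cube w2.
have [m wm m3] := prim_order_exists (isT : (0 < 3)%N) w3.
suff m1 : m != 1%N.
  by move: wm m1; case/primeP: (isT : prime 3) => _ /(_ m m3) /orP[] /eqP-> //.
apply: contra n3 => /eqP m1; move: (prim_expr_order wm); rewrite m1 expr1 => w1.
have -> : 3%:R = 1 - (- w - 1) :> R by rewrite w1; ring.
by rewrite -w2 w1 expr1n subrr.
Qed.

Lemma pchar_three (K : fieldType) l :
  prime l -> l != 3%N -> l \in [pchar K] -> 3%:R != 0 :> K.
Proof. by move=> l_prime l3 lK; rewrite -(dvdn_pcharf lK) dvdn_prime2. Qed.

Lemma modn3_sqr l : ~~ (3 %| l)%N -> (l ^ 2 = 1 %[mod 3])%N.
Proof.
rewrite -modnXm /dvdn; have := ltn_pmod l (isT : 0 < 3)%N.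
by case: (l %% 3)%N => [|[|[]]].
Qed.

Lemma divn3_sqr l : prime l -> l != 3%N ->
  ((l ^ 2).-1 %/ 3 * 3 = (l ^ 2).-1)%N.
Proof.
move=> l_prime l3; rewrite divnK // -subn1 -eqn_mod_dvd ?expn_gt0 ?prime_gt0 //.
by apply/eqP/modn3_sqr; rewrite dvdn_prime2 // eq_sym.
Qed.

Lemma Frobenius2_fixed (K : fieldType) (x : K) l :
  (0 < l)%N -> x != 0 -> x ^+ (l ^ 2) = x -> x ^+ (l ^ 2).-1 = 1.
Proof.
move=> l0 x0 e; apply: (mulIf x0).
by rewrite -exprSr prednK ?expn_gt0 ?l0 // mul1r.
Qed.

Lemma intr_Frobenius (K : fieldType) l (n : int) :
  l \in [pchar K] -> (n%:~R : K) ^+ l = n%:~R.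
Proof. by move=> lK; rewrite -(pFrobenius_autE lK) pFrobenius_aut_int. Qed.

(** Three times this quotient is l^2 - 1, which is even. Hence signs disappear when this power is
    taken. *)
Lemma divn3_sqr_even l : prime l -> l != 3%N -> l != 2%N ->
  odd ((l ^ 2).-1 %/ 3) = false.
Proof.
move=> l_prime l3 l2; have := divn3_sqr l_prime l3.
move/(congr1 odd); rewrite oddM andbT => ->.
rewrite -subn1 oddB ?expn_gt0 ?prime_gt0 // oddX /=.
by case: (even_prime l_prime) l2 => [->|->].
Qed.

(** The polynomial X^n - 1 has at most n roots, fewer than there are nonzero elements. *)
Lemma exists_power_neq1 (F : finFieldType) n :
  (0 < n < #|F|.-1)%N -> exists2 u : F, u != 0 & u ^+ n != 1.
Proof.
case/andP=> n0 nF.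
case: (pickP [pred u : F | (u != 0) && (u ^+ n != 1)]) => [u /andP[]|none].
  by exists u.
have /max_unity_roots : all n.-unity_root [seq u <- enum F | u != 0].
  apply/allP => u; rewrite mem_filter => /andP[u0 _].
  by apply/unity_rootP; move: (none u); rewrite /= u0 /= => /negbFE/eqP.
move=> /(_ n0 (filter_uniq _ (enum_uniq F))).
rewrite size_filter => /leq_trans/(_ (leqnn _)).
have -> : count (fun u : F => u != 0) (enum F) = #|F|.-1.
  rewrite -size_filter -(cardC1 (0 : F)) cardE /enum_mem -filter_predI.
  by congr size; apply: eq_filter => x; rewrite !inE andbT.
by rewrite leqNgt nF.
Qed.

(** Multiplication by some u with u^n different from 1 permutes F, yet scales the sum by u^n. *)
Lemma sum_powers_eq0 (F : finFieldType) n :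
  (0 < n < #|F|.-1)%N -> \sum_(t : F) t ^+ n = 0.
Proof.
move=> nF; have [u u0 un] := exists_power_neq1 nF.
have: u ^+ n * \sum_(t : F) t ^+ n = \sum_(t : F) t ^+ n.
  rewrite mulr_sumr [RHS](reindex_inj (mulfI u0)) /=.
  by apply: eq_bigr => t _; rewrite exprMn.
move/eqP; rewrite -subr_eq0 -{2}[\sum_t _]mul1r -mulrBl mulf_eq0 subr_eq0.
by rewrite (negbTE un) => /eqP.
Qed.

(** * Cubic characters, Gauss and Jacobi sums *)

Section CubicCharacter.

Variables (q : nat) (w0 : 'F_q).
Hypotheses (q_prime : prime q) (q_mod3 : q = 1 %[mod 3]).
Hypothesis w0E : w0 ^+ 2 = - w0 - 1.

Let k := (q.-1 %/ 3)%N.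

(** A discrete logarithm of [t ^+ (q.-1 %/ 3)] to base [w0]. Keeping the exponent lets the character
    be carried to any ring with a cube root of unity. The value at 0 is a mere default: [chi] treats
    0 apart. *)
Definition cubic_index (q : nat) (w0 t : 'F_q) : nat :=
  if t ^+ (q.-1 %/ 3) == 1 then 0%N
  else if t ^+ (q.-1 %/ 3) == w0 then 1%N else 2%N.

Local Notation ind := (cubic_index w0).

Lemma mod3_prime_gt6 : (6 < q)%N.
Proof.
case: q q_prime q_mod3 => [|[|[|[|[|[|[|n]]]]]]] //.
Qed.

Lemma cubic_exponent : (k * 3)%N = q.-1.
Proof.
by rewrite /k divnK // -subn1 -eqn_mod_dvd ?prime_gt0 //; apply/eqP.
Qed.

Lemma Fq_three_neq0 : 3%:R != 0 :> 'F_q.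
Proof.
rewrite -(dvdn_pcharf (pchar_Fp q_prime)); apply/negP => /dvdn_leq.
by move: mod3_prime_gt6; case: q => [|[|[|[]]]] // n ? /(_ isT).
Qed.

Lemma Fq_omega_prim : 3.-primitive_root w0.
Proof. exact: omega_prim w0E Fq_three_neq0. Qed.

Lemma Fq_expf_pred (t : 'F_q) : t != 0 -> t ^+ q.-1 = 1.
Proof.
move=> t0; apply: (mulfI t0).
rewrite -exprS prednK ?prime_gt0 // mulr1.
by rewrite -[RHS]expf_card card_Fp.
Qed.

Lemma cubic_index_spec t : t != 0 -> t ^+ k = w0 ^+ ind t.
Proof.
move=> t0; rewrite /cubic_index -/k.
have [->|n1] := eqVneq; first by rewrite expr0.
have [->|nw] := eqVneq; first by rewrite expr1.
have : (t ^+ k - 1) * (t ^+ k - w0) * (t ^+ k - w0 ^+ 2) = 0.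
  have: (t ^+ k) ^+ 3 = 1 by rewrite -exprM cubic_exponent Fq_expf_pred.
  by move: (t ^+ k) => x x3; ring: x3 w0E.
by move/eqP; rewrite !mulf_eq0 !subr_eq0 (negbTE n1) (negbTE nw) => /eqP.
Qed.

Lemma cubic_indexM s t :
  s != 0 -> t != 0 -> ind (s * t) = (ind s + ind t)%N %[mod 3].
Proof.
move=> s0 t0; apply/eqP; rewrite -(eq_prim_root_expr Fq_omega_prim) exprD.
by rewrite -!cubic_index_spec ?mulf_neq0 // exprMn.
Qed.

Section Values.

Variables (R : idomainType) (w : R).
Hypothesis wE : w ^+ 2 = - w - 1.

(** The ring of values varies: 'F_q itself, where the character is a power map, [algC] for the norm
    identity, and a closed field of characteristic l for reciprocity. *)
Definition chi (t : 'F_q) : R := if t == 0 then 0 else w ^+ ind t.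

Lemma omega_exp_mod i j : i = j %[mod 3] -> w ^+ i = w ^+ j.
Proof.
have w3 := omega_cube wE.
by move=> ij; rewrite -(expr_mod i w3) ij expr_mod.
Qed.

Lemma chiM s t : chi (s * t) = chi s * chi t.
Proof.
rewrite /chi mulf_eq0; have [_|s0] := eqVneq s; first by rewrite mul0r.
have [_|t0] := eqVneq t; rewrite ?mulr0 //= -exprD.
exact/omega_exp_mod/cubic_indexM.
Qed.

Lemma chi0 : chi 0 = 0. Proof. by rewrite /chi eqxx. Qed.

Lemma chi_cube t : t != 0 -> chi t ^+ 3 = 1.
Proof.
by move=> t0; rewrite /chi (negbTE t0) -exprM mulnC exprM omega_cube // expr1n.
Qed.

(** -1 is its own cube. *)
Lemma chiN1 : chi (-1) = 1.
Proof.
have -> : (-1 : 'F_q) = (-1) * (-1) * (-1) by rewrite mulN1r opprK mul1r.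
by rewrite !chiM -expr2 -exprSr chi_cube ?oppr_eq0 ?oner_eq0.
Qed.

Lemma sum_chi : 3%:R != 0 :> R -> \sum_t chi t = 0.
Proof.
move=> n3; have k_rng : (0 < k < #|'F_q|.-1)%N.
  by rewrite card_Fp //; move: cubic_exponent mod3_prime_gt6; clear; lia.
have [u u0 uk] := exists_power_neq1 k_rng.
have cu : chi u != 1.
  apply: contra uk; rewrite /chi (negbTE u0) cubic_index_spec //.
  by rewrite -(prim_order_dvd (omega_prim wE n3)) -(prim_order_dvd Fq_omega_prim).
have : chi u * \sum_t chi t = \sum_t chi t.
  rewrite mulr_sumr [RHS](reindex_inj (mulfI u0)) /=.
  by apply: eq_bigr => t _; rewrite chiM.
move/eqP; rewrite -subr_eq0 -{2}[\sum_t _]mul1r -mulrBl mulf_eq0 subr_eq0.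
by rewrite (negbTE cu) => /eqP.
Qed.

End Values.

Lemma chi_omega0 t : chi w0 t = t ^+ k.
Proof.
rewrite /chi; have [->|t0] := eqVneq; last by rewrite cubic_index_spec.
by rewrite expr0n; move: cubic_exponent mod3_prime_gt6; clear; case: k => //; lia.
Qed.

Lemma chi_sqr (R : idomainType) (w : R) t : chi (w ^+ 2) t = chi w t ^+ 2.
Proof. by rewrite /chi; case: eqP => // _; rewrite ?expr0n // exprAC. Qed.

End CubicCharacter.

Section GaussSum.

Variables (q : nat) (w0 : 'F_q).
Hypotheses (q_prime : prime q) (q_mod3 : q = 1 %[mod 3]).
Hypothesis w0E : w0 ^+ 2 = - w0 - 1.

Local Notation ind := (cubic_index w0).

Definition jacobi_sum (R : idomainType) (w : R) : R :=
  \sum_t chi w0 w t * chi w0 w (1 - t).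

Section Values.

Variables (R : idomainType) (zeta : R).
Hypotheses (zeta_q : zeta ^+ q = 1) (zeta_neq1 : zeta != 1).
Hypothesis R_three : 3%:R != 0 :> R.

Definition psi (t : 'F_q) : R := zeta ^+ t.

Lemma psiD s t : psi (s + t) = psi s * psi t.
Proof.
rewrite /psi -exprD /= -[LHS](expr_mod _ zeta_q) -[RHS](expr_mod _ zeta_q).
by congr (_ ^+ _); rewrite -[RHS]modn_mod; congr ((_ %% _) %% q)%N; apply: Fp_cast.
Qed.

Lemma psi0 : psi 0 = 1. Proof. by rewrite /psi expr0. Qed.

Lemma psiMn n t : psi (n%:R * t) = psi t ^+ n.
Proof.
elim: n => [|n IH]; first by rewrite mul0r psi0.
by rewrite -natr1 mulrDl mul1r psiD IH exprSr.
Qed.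

Lemma sum_psi (a : 'F_q) : \sum_t psi (a * t) = if a == 0 then q%:R else 0.
Proof.
have [->|a0] := eqVneq.
  under eq_bigr do rewrite mul0r psi0.
  by rewrite sumr_const card_Fp.
transitivity (\sum_t psi t); first by rewrite [RHS](reindex_inj (mulfI a0)).
have : zeta * \sum_t psi t = \sum_t psi t.
  rewrite mulr_sumr [RHS](reindex_inj (addrI 1)) /=.
  apply: eq_bigr => t _; by rewrite psiD; congr (_ * _).
move/eqP; rewrite -subr_eq0 -{2}[\sum_t _]mul1r -mulrBl mulf_eq0 subr_eq0.
by rewrite (negbTE zeta_neq1) => /eqP.
Qed.

Definition gauss_sum (w : R) : R := \sum_t chi w0 w t * psi t.

(* The conjugate of [chi w] is written [chi (w ^+ 2)]. *)
Lemma gauss_sum_twist (w : R) (a : 'F_q) : w ^+ 2 = - w - 1 ->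
  \sum_t chi w0 w t * psi (a * t) = chi w0 (w ^+ 2) a * gauss_sum w.
Proof.
move=> wE; have [->|a0] := eqVneq a 0.
  under eq_bigr do rewrite mul0r psi0 mulr1.
  by rewrite sum_chi // chi0 mul0r.
rewrite /gauss_sum [in RHS](reindex_inj (mulfI a0)) /= mulr_sumr.
apply: eq_bigr => t _; rewrite mulrA; congr (_ * _).
by rewrite (chiM q_prime) // mulrA chi_sqr -exprSr (chi_cube w0) ?mul1r.
Qed.

(** By the twist formula the product is the double sum of chi(t) psi((1 + t) a). Summing over a
    first leaves only t = -1, with weight q. *)
Lemma gauss_sum_norm (w : R) : w ^+ 2 = - w - 1 ->
  gauss_sum w * gauss_sum (w ^+ 2) = q%:R.
Proof.
move=> wE; rewrite mulrC {1}/gauss_sum mulr_suml.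
transitivity (\sum_(a : 'F_q) \sum_t chi w0 w t * psi ((1 + t) * a)).
  apply: eq_bigr => a _; rewrite mulrAC -gauss_sum_twist // mulr_suml.
  apply: eq_bigr => t _.
  by rewrite mulrDl mul1r psiD -mulrA [t * a]mulrC [psi a * _]mulrC.
rewrite exchange_big /= (bigD1 (-1)) //= -mulr_sumr sum_psi.
rewrite addrN eqxx (chiN1 q_prime) // mul1r big1 ?addr0 // => t tN1.
rewrite -mulr_sumr sum_psi addrC addr_eq0 (negbTE tN1).
by rewrite mulr0.
Qed.

(** Terms are grouped by v = s + t. For v = 0 the coefficient is the sum of chi^2, which vanishes;
    for v nonzero, s = v u extracts chi(v)^2 and leaves the Jacobi sum. *)
Lemma gauss_sum_sqr (w : R) : w ^+ 2 = - w - 1 ->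
  gauss_sum w ^+ 2 = jacobi_sum w * gauss_sum (w ^+ 2).
Proof.
move=> wE; rewrite [in RHS]/gauss_sum mulr_sumr.
transitivity (\sum_v (\sum_s chi w0 w s * chi w0 w (v - s)) * psi v).
  under [RHS]eq_bigr do rewrite mulr_suml.
  rewrite exchange_big /= expr2 {1}/gauss_sum mulr_suml.
  apply: eq_bigr => s _; rewrite [RHS](reindex_inj (addrI s)) /= mulr_sumr.
  apply: eq_bigr => t _; rewrite psiD addrC addKr; ring.
apply: eq_bigr => v _; rewrite mulrA; congr (_ * _).
have [->|v0] := eqVneq v 0.
  rewrite chi0 mulr0 -[RHS](sum_chi q_prime q_mod3 w0E (omega_sqr wE)) //.
  apply: eq_bigr => s _; rewrite sub0r -mulN1r (chiM q_prime) //.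
  by rewrite (chiN1 q_prime) // mul1r chi_sqr expr2.
rewrite (reindex_inj (mulfI v0)) mulr_suml /=; apply: eq_bigr => u _.
rewrite -{2}[v]mulr1 -mulrBr !(chiM q_prime) // chi_sqr; ring.
Qed.

Lemma gauss_sum_cube (w : R) : w ^+ 2 = - w - 1 ->
  gauss_sum w ^+ 3 = q%:R * jacobi_sum w.
Proof.
by move=> wE; rewrite exprS gauss_sum_sqr // mulrCA gauss_sum_norm // mulrC.
Qed.

Hypothesis R_q : q%:R != 0 :> R.

(** With g, h the two Gauss sums, g^2 = J h and h^2 = J' g give (g h)^2 = J J' g h, where g h = q
    can be cancelled. *)
Lemma jacobi_sum_norm (w : R) : w ^+ 2 = - w - 1 ->
  jacobi_sum w * jacobi_sum (w ^+ 2) = q%:R.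
Proof.
move=> wE; apply: (mulfI R_q).
have := gauss_sum_sqr (omega_sqr wE); have := gauss_sum_sqr wE.
have -> : (w ^+ 2) ^+ 2 = w by ring: wE.
have := gauss_sum_norm wE.
set g := gauss_sum w; set h := gauss_sum _ => gh g2 h2.
rewrite -gh; have: g ^+ 2 * h ^+ 2 = jacobi_sum w * jacobi_sum (w ^+ 2) * (g * h).
  by rewrite g2 h2; ring.
by move=> e; rewrite mulrC -e; ring.
Qed.

(** The l^2-th power is additive and fixes cube roots of unity, as l^2 = 1 mod 3. It turns psi(t)
    into psi(l^2 t), and the twist contributes chi(l)^4 = chi(l). *)
Lemma gauss_sum_Frobenius (w : R) l : w ^+ 2 = - w - 1 ->
    prime l -> l != 3%N -> l \in [pchar R] ->
  gauss_sum w ^+ (l ^ 2) = chi w0 w l%:R * gauss_sum w.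
Proof.
move=> wE l_prime l3 lR; rewrite expnS expn1 exprM.
rewrite -!(pFrobenius_autE lR) !rmorph_sum /=.
have l2 : (l * l = 1 %[mod 3])%N.
  by apply: modn3_sqr; rewrite dvdn_prime2 // eq_sym.
transitivity (\sum_t chi w0 w t * psi ((l * l)%:R * t)).
  apply: eq_bigr => t _; rewrite !rmorphM /= !pFrobenius_autE -natrM psiMn.
  rewrite -!(exprM _ l l).
  congr (_ * _); rewrite /chi; case: eqP => [_|_].
    by rewrite expr0n muln_eq0 orbb; case: l l_prime {l3 lR l2}.
  rewrite -exprM; apply: (omega_exp_mod wE).
  by rewrite -modnMmr l2 modnMmr muln1.
rewrite gauss_sum_twist // natrM (chiM q_prime) ?omega_sqr // !chi_sqr.
congr (_ * _); rewrite -exprD; have [->|l0] := eqVneq (l%:R : 'F_q) 0.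
  by rewrite chi0 expr0n.
by rewrite exprS (chi_cube w0) ?mulr1.
Qed.

(* The left-hand side is (g^3)^((l^2-1)/3) for the Gauss sum g, since
   g^3 = q J = J^2 J', and g^(l^2) = chi(l) g in characteristic l. *)
Lemma jacobi_sum_reciprocity (w : R) l : w ^+ 2 = - w - 1 ->
    prime l -> l != 3%N -> l \in [pchar R] ->
  (jacobi_sum w ^+ 2 * jacobi_sum (w ^+ 2)) ^+ ((l ^ 2).-1 %/ 3)
    = w ^+ ind l%:R.
Proof.
move=> wE l_prime l3 lR.
have -> : jacobi_sum w ^+ 2 * jacobi_sum (w ^+ 2) = gauss_sum w ^+ 3.
  by rewrite gauss_sum_cube // expr2 -mulrA jacobi_sum_norm // mulrC.
have g0 : gauss_sum w != 0.
  apply: contra R_q => /eqP g0; by rewrite -(gauss_sum_norm wE) g0 mul0r.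
rewrite -exprM mulnC divn3_sqr //; apply: (mulIf g0).
rewrite -exprSr prednK ?expn_gt0 ?prime_gt0 // gauss_sum_Frobenius //.
rewrite /chi ifN //; apply: contra R_q => l0.
have: (q %| l)%N by rewrite (dvdn_pcharf (pchar_Fp q_prime)).
by rewrite dvdn_prime2 // => /eqP->; rewrite (pcharf0 lR).
Qed.

End Values.

Definition jacobi_class (t : 'F_q) : nat := (ind t + ind (1 - t)) %% 3.

(** The number of terms of the Jacobi sum equal to w^i. It does not depend on the ring of values, so
    one Eisenstein integer gives the Jacobi sum in all of them. *)
Definition jacobi_count (i : nat) : nat :=
  #|[pred t : 'F_q | [&& t != 0, 1 - t != 0 & jacobi_class t == i]]|.

Lemma jacobi_sum_count (R : idomainType) (w : R) : w ^+ 2 = - w - 1 ->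
  jacobi_sum w = (jacobi_count 0)%:R + (jacobi_count 1)%:R * w
                 + (jacobi_count 2)%:R * w ^+ 2.
Proof.
move=> wE; rewrite /jacobi_count -!sum1_card !natr_sum !mulr_suml.
rewrite !(big_mkcond (fun t => t \in _)).
rewrite -!big_split /=; apply: eq_bigr => t _.
rewrite !inE /chi /jacobi_class; have [_|t0] := eqVneq t 0.
  by rewrite mul0r !addr0.
have [_|t1] := eqVneq (1 - t) 0; first by rewrite mulr0 !addr0.
rewrite /= -exprD -(expr_mod _ (omega_cube wE)).
have := ltn_pmod (ind t + ind (1 - t)) (isT : 0 < 3)%N.
by case: (_ %% 3)%N => [|[|[]]] //= _; rewrite ?expr0 ?expr1 ?mul1r ?addr0 ?add0r.
Qed.

End GaussSum.

(** A root of 1 + X + ... + X^(n-1); it could be 1 only if n = 0 in K. *)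
Lemma exists_unity_root (K : closedFieldType) n :
  (1 < n)%N -> n%:R != 0 :> K -> exists2 z : K, z ^+ n = 1 & z != 1.
Proof.
move=> n1 nK; pose P : {poly K} := \poly_(i < n) 1.
have sP : size P = n by rewrite size_poly_eq // oner_neq0.
have /closed_rootP[z /rootP zP] : size P != 1%N by rewrite sP gtn_eqF.
have {}zP : \sum_(i < n) z ^+ i = 0.
  by rewrite -[RHS]zP horner_poly; apply: eq_bigr => i _; rewrite mul1r.
exists z; first by apply/eqP; rewrite -subr_eq0 subrX1 zP mulr0.
apply: contra nK => /eqP z1; rewrite -zP z1.
by under eq_bigr do rewrite expr1n; rewrite sumr_const card_ord.
Qed.

Lemma exists_omega (K : closedFieldType) :
  3%:R != 0 :> K -> exists w : K, w ^+ 2 = - w - 1.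
Proof.
move=> K3; have [w w3 w1] := exists_unity_root (isT : (1 < 3)%N) K3.
exists w; apply: (mulfI (_ : w - 1 != 0)); first by rewrite subr_eq0.
by ring: w3.
Qed.

(** Every orbit of f in A has exactly three elements. *)
Lemma card_free_order3 (T : finType) (f : T -> T) (A : {pred T}) :
    injective f -> fclosed f A ->
    {in A, forall x, f (f (f x)) = x} -> {in A, forall x, f x != x} ->
  (3 %| #|A|)%N.
Proof.
move=> f_inj fA f3 f1; rewrite -(fcard_order_set f_inj (n := 3)) ?dvdn_mull //.
apply/subsetP => x xA; have fxA : f x \in A by rewrite -(fA _ _ (eqxx _)).
have n1 := f1 _ xA; have e3 := f3 _ xA.
have n2 : f (f x) != x.
  by apply: contra n1 => /eqP e; move: e3; rewrite e => ->.
rewrite inE (order_cycle (p := [:: x; f x; f (f x)])) ?inE ?eqxx //=.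
  by rewrite e3 !eqxx.
by rewrite !inE negb_or ![x == _]eq_sym n1 n2 eq_sym f1.
Qed.

(** * Jacobi sums as Eisenstein integers *)

Section JacobiIntegers.

Variables (q : nat) (w0 : 'F_q).
Hypotheses (q_prime : prime q) (q_mod3 : q = 1 %[mod 3]).
Hypothesis w0E : w0 ^+ 2 = - w0 - 1.

Let k := (q.-1 %/ 3)%N.
Let k3 : (k * 3)%N = q.-1 := cubic_exponent q_prime q_mod3.

Lemma cubes_exp (x : 'F_q) : x != 0 -> (x ^+ 3) ^+ k = 1.
Proof. by move=> x0; rewrite -exprM mulnC k3 (Fq_expf_pred q_prime). Qed.

Lemma jacobi_class_exp t :
  t != 0 -> 1 - t != 0 -> w0 ^+ jacobi_class w0 t = (t * (1 - t)) ^+ k.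
Proof.
move=> t0 t1; rewrite expr_mod; last exact: omega_cube.
by rewrite exprD -!(cubic_index_spec q_prime) // exprMn.
Qed.

(* The substitution [t -> 1 / (1 - t)] has order three and preserves the value
   of [chi t * chi (1 - t)]; its fixed points satisfy [t * (1 - t) = 1]. *)
Lemma dvdn_jacobi_count i : (0 < i < 3)%N -> (3 %| jacobi_count w0 i)%N.
Proof.
case/andP=> i0 i3; pose f (t : 'F_q) := (1 - t)^-1.
have f_inj : injective f by move=> x y /invr_inj /addrI /oppr_inj.
pose good (t : 'F_q) := (t != 0) && (1 - t != 0).
have goodf t : good (f t) = good t.
  rewrite /good /f invr_eq0; have [t1|t1] := eqVneq (1 - t) 0.
    by rewrite andbF.
  have -> : 1 - (1 - t)^-1 = - t / (1 - t) by field.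
  by rewrite mulf_eq0 oppr_eq0 invr_eq0 (negbTE t1) orbF andbT.
have classf t : good t -> jacobi_class w0 (f t) = jacobi_class w0 t.
  move=> gt; have /andP[t0 t1] := gt; have := gt; rewrite -goodf => /andP[f0 f1].
  rewrite -[LHS]modn_mod -[RHS]modn_mod; apply/eqP.
  rewrite -(eq_prim_root_expr (Fq_omega_prim q_prime q_mod3 w0E)).
  rewrite !jacobi_class_exp //.
  have -> : f t * (1 - f t) = t * (1 - t) * (- (1 - t)^-1) ^+ 3.
    by rewrite /f; field.
  by rewrite exprMn cubes_exp ?mulr1 // oppr_eq0 invr_eq0.
apply: (card_free_order3 f_inj) => [x y /eqP <-|t|t]; rewrite !inE.
- have := goodf x; rewrite !andbA -!/(good _) => ->.
  by have [/classf->|] := boolP (good x).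
- case/and3P=> t0 t1 _; rewrite /f.
  have e : 1 - (1 - t)^-1 = - t / (1 - t) by field.
  rewrite e; have -> : 1 - (- t / (1 - t))^-1 = t^-1.
    by field; rewrite t1 oppr_eq0 t0.
  by rewrite invrK.
- case/and3P=> t0 t1; apply: contraTneq => e.
  have e1 : t * (1 - t) = 1 by rewrite -{1}e mulVf.
  have : w0 ^+ jacobi_class w0 t = w0 ^+ 0.
    by rewrite jacobi_class_exp // e1 expr1n expr0.
  move/eqP; rewrite (eq_prim_root_expr (Fq_omega_prim q_prime q_mod3 w0E)).
  rewrite /jacobi_class modn_mod.
  by move/eqP->; rewrite mod0n eq_sym -lt0n.
Qed.

(** Coordinates of the Jacobi sum in the basis 1, w, after replacing w^2 by - w - 1. *)
Definition jacobi_re : int := (jacobi_count w0 0)%:Z - (jacobi_count w0 2)%:Z.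
Definition jacobi_im : int := (jacobi_count w0 1)%:Z - (jacobi_count w0 2)%:Z.

Lemma jacobi_sumE (R : idomainType) (w : R) : w ^+ 2 = - w - 1 ->
  jacobi_sum w0 w = jacobi_re%:~R + jacobi_im%:~R * w.
Proof.
move=> wE; rewrite jacobi_sum_count // wE /jacobi_re /jacobi_im !rmorphB /=.
by rewrite -!pmulrn; ring.
Qed.

Lemma dvdz_jacobi_im : (3 %| jacobi_im)%Z.
Proof. by rewrite /jacobi_im rpredB // dvdzE; apply: dvdn_jacobi_count. Qed.

(** The identity J J' = q is read in [algC], into which the integers embed. *)
Lemma jacobi_norm :
  jacobi_re ^+ 2 - jacobi_re * jacobi_im + jacobi_im ^+ 2 = q%:Z.
Proof.
have n0 n : (0 < n)%N -> n%:R != 0 :> algC by rewrite pnatr_eq0 lt0n.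
have [w wE] := exists_omega (n0 3 isT).
have nq := n0 _ (prime_gt0 q_prime).
have [z zq z1] := exists_unity_root (prime_gt1 q_prime) nq.
have := jacobi_sum_norm q_prime q_mod3 w0E zq z1 (n0 3 isT) nq wE.
rewrite !jacobi_sumE ?omega_sqr //; move: jacobi_re jacobi_im => a b e.
apply: (@intr_inj algC); rewrite -[RHS]pmulrn -e.
by ring: wE.
Qed.

(** With values in 'F_q, the Jacobi sum is the sum of t^k (1 - t)^k, whose exponents lie between k
    and 2 k < q - 1, so all power sums vanish. Thus J lies in the prime above q at which w reduces
    to [w0]. *)
Lemma jacobi_root : jacobi_re%:~R + jacobi_im%:~R * w0 = 0.
Proof.
rewrite -jacobi_sumE // /jacobi_sum.
under eq_bigr do rewrite !(chi_omega0 q_prime) // -/k exprBn mulr_sumr.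
rewrite exchange_big /= big1 // => i _.
under eq_bigr do rewrite expr1n mulr1 mulrnAr mulrCA -exprD.
rewrite sumrMnl -mulr_sumr sum_powers_eq0 ?mulr0 ?mul0rn //.
rewrite card_Fp // -k3; have := ltn_ord i.
have := mod3_prime_gt6 q_prime q_mod3; move: k3.
by clear; lia.
Qed.

Lemma jacobi_reciprocity (K : closedFieldType) (w : K) l :
    w ^+ 2 = - w - 1 -> prime l -> l != 3%N -> l != q -> l \in [pchar K] ->
  let z := jacobi_re%:~R + jacobi_im%:~R * w in
  let z' := jacobi_re%:~R + jacobi_im%:~R * w ^+ 2 in
  (z ^+ 2 * z') ^+ ((l ^ 2).-1 %/ 3) = w ^+ cubic_index w0 l%:R.
Proof.
move=> wE l_prime l3 lq lK z z'.
have nK n : prime n -> l != n -> n%:R != 0 :> K.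
  by move=> pn ln; rewrite -(dvdn_pcharf lK) dvdn_prime2.
have [y yq y1] := exists_unity_root (prime_gt1 q_prime) (nK _ q_prime lq).
rewrite /z /z' -!jacobi_sumE ?omega_sqr //.
have [n3 nq] := (nK 3%N isT l3, nK _ q_prime lq).
exact: (jacobi_sum_reciprocity q_prime q_mod3 w0E yq y1 n3 nq).
Qed.

End JacobiIntegers.

(** * Cubic residue symbols *)

Definition eisnorm (a b : int) : int := a ^+ 2 - a * b + b ^+ 2.

(** The image of a + b w in R; the conjugate is obtained by passing [w ^+ 2]. *)
Definition eisval (R : nzRingType) (w : R) (a b : int) : R := a%:~R + b%:~R * w.

(* [w ^+ e n] is the cubic residue symbol of the integer n modulo the Eisenstein
   integer z = a + b w.  The last field is cubic reciprocity; using z^2 z' (z' the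
   conjugate of z) instead of z makes it hold for l = 1 and l = 2 mod 3 alike. *)
Record cubic_symbol (a b : int) (e : int -> nat) : Prop := CubicSymbol {
  cubic_symbolM m n : coprimez m (eisnorm a b) -> coprimez n (eisnorm a b) ->
    e (m * n) = (e m + e n)%N %[mod 3];
  cubic_symbol_mod m n : coprimez m (eisnorm a b) ->
    (eisnorm a b %| m - n)%Z -> e m = e n %[mod 3];
  cubic_symbol_prime (K : closedFieldType) (w : K) l :
    w ^+ 2 = - w - 1 -> prime l -> l != 3%N -> coprimez l (eisnorm a b) ->
    l \in [pchar K] ->
    (eisval w a b ^+ 2 * eisval (w ^+ 2) a b) ^+ ((l ^ 2).-1 %/ 3)
      = w ^+ e l }.

Lemma eisval_norm (R : comNzRingType) (w : R) a b : w ^+ 2 = - w - 1 ->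
  eisval w a b * eisval (w ^+ 2) a b = (eisnorm a b)%:~R.
Proof. by move=> wE; rewrite /eisval /eisnorm; ring: wE. Qed.

(** An element of order 3 forces 3 to divide q - 1. *)
Lemma Fq_omega_mod3 q (w : 'F_q) :
  prime q -> q != 3%N -> w ^+ 2 = - w - 1 -> q = 1 %[mod 3].
Proof.
move=> q_prime q3 wE; have w_prim : 3.-primitive_root w.
  by apply: omega_prim => //; rewrite -(dvdn_pcharf (pchar_Fp q_prime)) dvdn_prime2.
apply/eqP; rewrite eqn_mod_dvd ?prime_gt0 // subn1 (prim_order_dvd w_prim).
rewrite Fq_expf_pred //; apply: contra_eq_neq wE => ->.
by rewrite expr0n /= oppr0 add0r eq_sym oppr_eq0 oner_eq0.
Qed.

Lemma eisnorm_ge0 a b : 0 <= eisnorm a b.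
Proof.
have h1 := sqr_ge0 (2 * a - b); have h2 := sqr_ge0 b.
by rewrite /eisnorm; lia.
Qed.

Lemma eisnorm_primary a b : (3 %| b)%Z -> ~~ (3 %| a)%Z -> ~~ (3 %| eisnorm a b)%Z.
Proof.
move=> /dvdzP[c ->]; apply: contra => /dvdzP[d]; rewrite /eisnorm => e.
have: (3 %| a ^+ 2)%Z by apply/dvdzP; exists (d + a * c - 3 * c ^+ 2); lia.
by rewrite !dvdzE abszX Euclid_dvdX //= andbT.
Qed.

Lemma eisnorm_root (F : fieldType) (w : F) a b :
    b%:~R != 0 :> F -> (eisnorm a b)%:~R = 0 :> F -> eisval w a b = 0 ->
  w ^+ 2 = - w - 1.
Proof.
rewrite /eisnorm /eisval => b0 N0 /eqP; rewrite addr_eq0 => /eqP aE.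
apply: (mulfI (expf_neq0 2 b0)); apply/eqP; rewrite -subr_eq0 -[X in _ == X]N0.
by apply/eqP; ring: aE.
Qed.

(** The two integers are the coordinates of (a + b w) times the conjugate of r + i w. Their
    vanishing modulo q = J J' is what makes a + b w divisible by J = r + i w. *)
Lemma eisval0_mul_conj (R : comNzRingType) (w : R) a b r i :
    w ^+ 2 = - w - 1 -> eisval w a b = 0 -> eisval w r i = 0 ->
  (a * r - a * i + b * i)%:~R = 0 :> R /\ (b * r - a * i)%:~R = 0 :> R.
Proof.
rewrite /eisval => wE /eqP; rewrite addr_eq0 => /eqP aE.
by move=> /eqP; rewrite addr_eq0 => /eqP rE; split; ring: aE rE wE.
Qed.

(* A rational prime dividing both a and b can be split off because it contributes
   its cube to z^2 z'.  Any other prime divisor q of the norm is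
   1 mod 3, and a Jacobi sum of norm q divides a + b w. *)
Lemma exists_cubic_symbol a b :
  (3 %| b)%Z -> ~~ (3 %| a)%Z -> exists e, cubic_symbol a b e.
Proof.
have [n] := ubnP `|eisnorm a b|%N; elim: n a b => // n IH a b leN b3 a3.
have N3 := eisnorm_primary b3 a3; have N0 := eisnorm_ge0 a b.
have [N1|N1] := eqVneq (eisnorm a b) 1.
  (* The norm is at least 3 b^2 / 4, so norm 1 and 3 | b leave only z = 1 or -1, with trivial
     symbol. *)
  have [c bE] := dvdzP b3.
  have b0 : b = 0 by move: N1; rewrite bE /eisnorm => N1; nia.
  have a2 : a ^+ 2 = 1 by move: N1; rewrite b0 /eisnorm mulr0 expr0n subr0 addr0.
  exists (fun=> 0%N); split=> // K w l wE l_prime l3 _ lK.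
  rewrite /eisval b0 !mul0r addr0 expr0.
  have -> : (a%:~R : K) ^+ 2 = 1 by rewrite -rmorphXn /= a2.
  rewrite mul1r; have [la|l2] := eqVneq l 2%N.
    move/eqP: a2; rewrite sqrf_eq1 => /orP[] /eqP->; rewrite ?expr1n //.
    by rewrite rmorphN1 oppr_pchar2 -?la // expr1n.
  have := divn3_sqr_even l_prime l3 l2; move: (_ %/ 3)%N => m m_even.
  rewrite -[m]odd_double_half m_even.
  by rewrite add0n -mul2n exprM -rmorphXn /= a2 expr1n.
have [q q_prime qN] : exists2 q, prime q & (q %| eisnorm a b)%Z.
  exists (pdiv `|eisnorm a b|); last by rewrite dvdzE pdiv_dvd.
  by apply: pdiv_prime; move: N0 N1 N3; case: (eisnorm a b) => [[|[|m]]|m].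
have q3 : q != 3%N by apply: contraNneq N3 => q3; rewrite -[3]/(3%N%:Z) -q3.
have qF m : (q %| m)%Z = (m%:~R == 0 :> 'F_q) := dvdz_pcharf (pchar_Fp q_prime) m.
have Nq : (eisnorm a b)%:~R = 0 :> 'F_q by apply/eqP; rewrite -qF.
have q3n : (3 %| q)%N = false.
  by rewrite dvdn_prime2 // eq_sym (negbTE q3).
have q1 : (q == 1%N) = false by rewrite gtn_eqF ?prime_gt1.
have Npos : 0 < eisnorm a b.
  by rewrite lt_neqAle N0 andbT eq_sym; apply: contraNneq N3 => ->.
have [qb|qb] := boolP (q %| b)%Z.
  have qa : (q %| a)%Z.
    have : (q %| a ^+ 2)%Z.
      have -> : a ^+ 2 = eisnorm a b + b * (a - b) by rewrite /eisnorm; ring.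
      by rewrite rpredD ?dvdz_mulr.
    by rewrite !dvdzE abszX Euclid_dvdX //= andbT.
  have [a' aE] := dvdzP qa; have [b' bE] := dvdzP qb.
  have NE : eisnorm a b = eisnorm a' b' * (q%:Z ^+ 2).
    by rewrite /eisnorm aE bE; ring.
  have [||| e [eM e_mod eP]] := IH a' b'.
  - rewrite -ltnS; apply: leq_trans leN; rewrite ltnS NE.
    rewrite abszM abszX ltn_Pmulr ?(ltn_exp2l 0) ?prime_gt1 // absz_gt0.
    by apply: contraTneq Npos; rewrite NE => ->; rewrite mul0r ltxx.
  - by move: b3; rewrite bE !dvdzE abszM Euclid_dvdM //= q3n orbF.
  - by apply: contra a3 => a'3; rewrite aE dvdz_mulr.
  exists e; split.
  - by move=> m m'; rewrite NE !coprimezMr => /andP[m1 _] /andP[m2 _]; apply: eM.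
  - move=> m m'; rewrite NE !coprimezMr => /andP[m1 _] h; apply: e_mod => //.
    by apply: dvdz_trans h; apply: dvdz_mulr.
  move=> K w l wE l_prime l3; rewrite NE coprimezMr => /andP[lN lq] lK.
  rewrite -(eP K w l wE l_prime l3 lN lK).
  have eisE x : eisval x a b = (q%:Z)%:~R * eisval x a' b' :> K.
    by rewrite /eisval aE bE !rmorphM /=; ring.
  have qK : (q%:Z)%:~R != 0 :> K.
    rewrite -(dvdz_pcharf lK) dvdzE /= dvdn_prime2 //; apply: contraTneq lq => ->.
    by rewrite expr2 coprimezMr coprimezE /= /coprime gcdnn q1.
  rewrite !eisE.
  have -> (Q z z' : K) : (Q * z) ^+ 2 * (Q * z') = Q ^+ 3 * (z ^+ 2 * z') by ring.
  rewrite exprMn -exprM mulnC divn3_sqr // Frobenius2_fixed ?mul1r ?prime_gt0 //.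
  by rewrite expnS expn1 exprM !intr_Frobenius.
have b0 : b%:~R != 0 :> 'F_q by rewrite -qF.
(* [w0] is the image of w modulo a prime above q that divides a + b w. The Jacobi sum built on this
   [w0] lies in the same prime. *)
have [w0 aw] : exists w0 : 'F_q, eisval w0 a b = 0.
  by exists (- (a%:~R / b%:~R)); rewrite /eisval mulrN mulrC divfK // subrr.
have w0E := eisnorm_root b0 Nq aw.
have q_mod3 := Fq_omega_mod3 q_prime q3 w0E.
have := jacobi_norm q_prime q_mod3 w0E; have := jacobi_root q_prime q_mod3 w0E.
have := dvdz_jacobi_im q_prime q_mod3 w0E.
have := jacobi_reciprocity q_prime q_mod3 w0E.
move: (jacobi_re w0) (jacobi_im w0) => r i recip i3 rw normq.
have [/eqP + /eqP] := eisval0_mul_conj w0E aw rw.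
rewrite -!qF => /dvdzP[A AE] /dvdzP[B BE].
have q0 : q%:Z != 0 by rewrite eqz_nat -lt0n prime_gt0.
(* Cancelling q = J J' in z J' = q (A + B w) gives z = (A + B w) J, coordinate by coordinate. *)
have aE : a = A * r - B * i.
  apply: (mulIf q0); rewrite mulrBl ![_ * _ * q%:Z]mulrAC.
  by rewrite -AE -BE -normq; ring.
have bE : b = A * i + B * r - B * i.
  apply: (mulIf q0); rewrite mulrBl mulrDl ![_ * _ * q%:Z]mulrAC.
  by rewrite -AE -BE -normq; ring.
have NE : eisnorm a b = eisnorm A B * q%:Z by rewrite -normq /eisnorm aE bE; ring.
have [||| e [eM e_mod eP]] := IH A B.
- rewrite -ltnS; apply: leq_trans leN; rewrite ltnS NE.
  rewrite abszM ltn_Pmulr ?prime_gt1 // absz_gt0.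
  by apply: contraTneq Npos; rewrite NE => ->; rewrite mul0r ltxx.
- have : (3 %| B * q%:Z)%Z.
    by rewrite -BE rpredB ?(dvdz_mulr _ b3) ?(dvdz_mull _ i3).
  by rewrite !dvdzE abszM Euclid_dvdM //= q3n orbF.
- by apply: contra a3 => A3; rewrite aE rpredB ?(dvdz_mulr _ A3) ?(dvdz_mull _ i3).
have co m : coprimez m q -> m%:~R != 0 :> 'F_q.
  by rewrite -qF coprimezE /= coprime_sym prime_coprime // dvdzE.
(* The symbol modulo z is the product of the symbol modulo A + B w and the cubic character modulo
   q. *)
exists (fun m => e m + cubic_index w0 m%:~R)%N; split.
- move=> m m'; rewrite NE !coprimezMr => /andP[m1 /co mq] /andP[m2 /co mq'].
  rewrite -modnDm eM // rmorphM /= (cubic_indexM q_prime) // modnDm.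
  by rewrite addnACA.
- move=> m m'; rewrite NE !coprimezMr => /andP[m1 /co mq] h.
  rewrite -modnDm (e_mod m m') //; last by apply: dvdz_trans h; apply: dvdz_mulr.
  have : (q %| m - m')%Z by apply: dvdz_trans h; apply: dvdz_mull.
  by rewrite qF rmorphB /= subr_eq0 => /eqP->; rewrite modnDm.
move=> K w l wE l_prime l3; rewrite NE coprimezMr => /andP[lN lq] lK.
have lq' : l != q.
  by apply: contraTneq lq => ->; rewrite coprimezE /= /coprime gcdnn q1.
rewrite exprD -(eP K w l wE l_prime l3 lN lK) -[l%:~R]pmulrn.
rewrite -(recip K w l wE l_prime l3 lq' lK) -exprMn; congr (_ ^+ _).
by rewrite /eisval aE bE; ring: wE.
Qed.

Lemma exists_Fp_closure p :
  exists K : closedFieldType, inhabited {rmorphism 'F_p -> K}.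
Proof.
by have [K [f _]] := countable_algebraic_closure 'F_p; exists K; split.
Qed.

Lemma pchar_closure p (K : closedFieldType) (f : {rmorphism 'F_p -> K}) :
  prime p -> p \in [pchar K].
Proof. by move=> p_prime; rewrite (fmorph_pchar f) pchar_Fp. Qed.

Lemma omega_exp_eq1 (K : fieldType) (w : K) n :
  w ^+ 2 = - w - 1 -> 3%:R != 0 :> K -> (w ^+ n == 1) = (3 %| n)%N.
Proof. by move=> wE K3; rewrite -(prim_order_dvd (omega_prim wE K3)). Qed.

Lemma omega_Frobenius2 (K : fieldType) (w : K) l :
  w ^+ 2 = - w - 1 -> prime l -> l != 3%N -> w ^+ (l ^ 2) = w.
Proof.
move=> wE l_prime l3; rewrite -[RHS]expr1; apply: (omega_exp_mod wE).
by apply: modn3_sqr; rewrite dvdn_prime2 // eq_sym.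
Qed.

Lemma eisval_Frobenius2 (K : fieldType) (w : K) l a b :
    w ^+ 2 = - w - 1 -> prime l -> l != 3%N -> l \in [pchar K] ->
  eisval w a b ^+ (l ^ 2) = eisval w a b.
Proof.
move=> wE l_prime l3 lK.
rewrite -[in RHS](omega_Frobenius2 wE l_prime l3) expnS expn1 !exprM.
by rewrite -!(pFrobenius_autE lK) /eisval !rmorphD !rmorphM /= !pFrobenius_aut_int.
Qed.

Lemma coprimez_primes (m n : int) : (m != 0) || (n != 0) ->
    (forall l : nat, prime l -> (l %| m)%Z -> (l %| n)%Z -> False) ->
  coprimez m n.
Proof.
move=> mn nol; rewrite coprimezE /coprime; apply/negPn/negP => g1.
have gp : (0 < gcdn `|m| `|n|)%N by rewrite gcdn_gt0 !absz_gt0.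
apply: (nol (pdiv (gcdn `|m| `|n|))); first by apply: pdiv_prime; lia.
  by rewrite dvdzE (dvdn_trans (pdiv_dvd _)) ?dvdn_gcdl.
by rewrite dvdzE (dvdn_trans (pdiv_dvd _)) ?dvdn_gcdr.
Qed.

Lemma dvdzXn_prime (l : nat) (m : int) n :
  prime l -> (l %| m ^+ n)%Z -> (l %| m)%Z.
Proof. by move=> l_prime; rewrite !dvdzE abszX Euclid_dvdX // => /andP[]. Qed.

Lemma dvdzM_prime (l : nat) (m n : int) :
  prime l -> (l %| m * n)%Z = (l %| m)%Z || (l %| n)%Z.
Proof. by move=> l_prime; rewrite !dvdzE abszM Euclid_dvdM. Qed.

(** * Values of the cubic symbol at divisors of the trace and at 2 *)

Section CubicSymbolTheory.

Variables (a b : int) (e : int -> nat).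
Hypothesis abe : cubic_symbol a b e.
Let N := eisnorm a b.

Lemma cubic_symbol1 : (3 %| e 1)%N.
Proof.
have c1 : coprimez 1 N by rewrite coprimezE coprime1n.
by have := cubic_symbolM abe c1 c1; rewrite mulr1; lia.
Qed.

Lemma cubic_symbol_sqr m : coprimez m N -> (3 %| e (m ^+ 2))%N = (3 %| e m)%N.
Proof. by move=> mN; have := cubic_symbolM abe mN mN; rewrite -expr2; lia. Qed.

Lemma cubic_symbol_cubeM m n : coprimez m N -> coprimez n N ->
  (e (m ^+ 3 * n) = e n %[mod 3])%N.
Proof.
move=> mN nN; have m2N : coprimez (m ^+ 2) N by rewrite coprimezXl.
have m3N : coprimez (m ^+ 3) N by rewrite coprimezXl.
have := cubic_symbolM abe m3N nN; have := cubic_symbolM abe mN m2N.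
by have := cubic_symbolM abe mN mN; rewrite -exprS -expr2; lia.
Qed.

(* If l divides the trace of z then z' = - z modulo l, so z^2 z' = - z^3. *)
Lemma cubic_symbol_trace_prime l : prime l -> l != 3%N -> coprimez l N ->
  (l %| 2 * a - b)%Z -> (3 %| e l)%N.
Proof.
move=> l_prime l3 lN lT; have [K [f]] := exists_Fp_closure l.
have lK := pchar_closure f l_prime; have K3 := pchar_three l_prime l3 lK.
have [w wE] := exists_omega K3; rewrite -(omega_exp_eq1 _ wE K3).
rewrite -(cubic_symbol_prime abe wE l_prime l3 lN lK).
have T0 : (2 * a - b)%:~R = 0 :> K by apply/eqP; rewrite -(dvdz_pcharf lK).
have zz : eisval (w ^+ 2) a b = - eisval w a b.
  apply/eqP; rewrite -subr_eq0 opprK -[X in _ == X]T0 /eisval.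
  by apply/eqP; ring: wE.
have z0 : eisval w a b != 0.
  have : (eisnorm a b)%:~R != 0 :> K.
    rewrite -(dvdz_pcharf lK) dvdzE; move: lN.
    by rewrite coprimezE /= prime_coprime.
  by rewrite -(eisval_norm _ _ wE); apply: contraNneq => ->; rewrite mul0r.
rewrite zz mulrN -exprSr -mulN1r exprMn -exprM mulnC divn3_sqr //.
rewrite Frobenius2_fixed ?eisval_Frobenius2 ?prime_gt0 // mulr1.
have [l2|l2] := eqVneq l 2%N.
  by rewrite oppr_pchar2 -?l2 // expr1n.
by rewrite -signr_odd divn3_sqr_even.
Qed.

(** Prime factors are split off one by one. The sign is harmless since (-1)^2 = 1 and doubling is
    injective modulo 3. *)
Lemma cubic_symbol_trace n : ~~ (3 %| n)%Z -> coprimez n N ->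
  (n %| 2 * a - b)%Z -> (3 %| e n)%N.
Proof.
move: {2}`|n|%N (leqnn `|n|) => k; elim: k n => [|k IH] n nk n3 nN nT.
  by move: nk n3; rewrite leqn0 absz_eq0 => /eqP->; rewrite dvdz0.
have [n1|n1] := eqVneq `|n|%N 1%N.
  have [->|nN1] := eqVneq n 1; first exact: cubic_symbol1.
  have {nN1}-> : n = -1 by lia.
  have c1 : coprimez (-1) N by rewrite coprimeNz coprimezE coprime1n.
  by rewrite -(cubic_symbol_sqr c1) sqrrN expr1n cubic_symbol1.
have n0 : n != 0 by apply: contraNneq n3 => ->; rewrite dvdz0.
pose l := pdiv `|n|; have l_prime : prime l by apply: pdiv_prime; lia.
have ln : (l %| n)%Z by rewrite dvdzE pdiv_dvd.
have [m nE] := dvdzP ln.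
have l3 : l != 3%N by apply: contraNneq n3 => l3; rewrite -[3]/(3%N%:Z) -l3.
move: nN; rewrite nE coprimezMl => /andP[mN lN].
have mT : (m %| 2 * a - b)%Z by apply: dvdz_trans nT; rewrite nE dvdz_mulr.
have lT : (l %| 2 * a - b)%Z by apply: dvdz_trans nT.
have m3 : ~~ (3 %| m)%Z by apply: contra n3 => m3; rewrite nE dvdz_mulr.
have mk : (`|m| <= k)%N.
  rewrite -ltnS; apply: leq_trans nk; rewrite nE abszM ltn_Pmulr ?prime_gt1 //.
  by rewrite absz_gt0; apply: contraNneq m3 => ->; rewrite dvdz0.
rewrite /dvdn (cubic_symbolM abe mN lN) -/(dvdn 3 _) dvdn_add //.
  exact: IH.
exact: cubic_symbol_trace_prime.
Qed.

(** For l = 2 the exponent (l^2 - 1) / 3 is 1, and z^2 z' = z N = z as N is odd. With b odd, z is w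
    or 1 + w in characteristic 2, never 1. *)
Lemma cubic_symbol_two : ~~ (2 %| b)%Z -> ~~ (3 %| e 2)%N.
Proof.
move=> b2; have [K [f]] := exists_Fp_closure 2.
have K2 := pchar_closure f (isT : prime 2).
have K3 := pchar_three (isT : prime 2) isT K2.
have [w wE] := exists_omega K3; rewrite -(omega_exp_eq1 _ wE K3).
have N2 : ~~ (2 %| N)%Z.
  have [d bE] : exists d, b = 2 * d + 1 by exists (b %/ 2)%Z; lia.
  have [c [] aE] : exists c, a = 2 * c \/ a = 2 * c + 1 by exists (a %/ 2)%Z; lia.
    by rewrite /N /eisnorm aE bE; lia.
  by rewrite /N /eisnorm aE bE; lia.
have cN : coprimez 2%N N by move: N2; rewrite coprimezE dvdzE /= prime_coprime.
rewrite -(cubic_symbol_prime abe wE (isT : prime 2) isT cN K2) expr1.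
have odd1 m : ~~ (2 %| m)%Z -> m%:~R = 1 :> K.
  move=> m2; have : (2 %| m - 1)%Z by lia.
  by rewrite (dvdz_pcharf K2) rmorphB subr_eq0 => /eqP.
rewrite expr2 -mulrA eisval_norm // -/N (odd1 N) // mulr1 /eisval (odd1 b) // mul1r.
have [a2|/odd1->] := boolP (2 %| a)%Z.
  move: a2; rewrite (dvdz_pcharf K2) => /eqP->; rewrite add0r.
  by rewrite -[w]expr1 omega_exp_eq1.
rewrite -subr_eq0 addrC addKr; apply: contra_eq_neq wE => ->.
by rewrite expr0n /= oppr0 add0r eq_sym oppr_eq0 oner_eq0.
Qed.

End CubicSymbolTheory.

Lemma coprimez_prime (l : nat) n :
  prime l -> coprimez l n = ~~ (l %| n)%Z.
Proof. by move=> l_prime; rewrite coprimezE dvdzE /= prime_coprime. Qed.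

(** * The symbol of p for the forms of discriminant -23 *)

(** A common prime factor l would give l^2 | m p with l prime to m, hence l^2 | p. *)
Lemma form23_coprime (p m l : nat) (X Y : int) :
    prime p -> prime l -> ~~ (l %| m)%N ->
    m%:Z * p%:Z = X ^+ 2 + 23 * Y ^+ 2 -> (l %| X)%Z -> (l %| Y)%Z -> False.
Proof.
move=> p_prime l_prime lm mp /dvdzP[x xE] /dvdzP[y yE].
have : (l%:Z ^+ 2 %| m%:Z * p%:Z)%Z.
  by apply/dvdzP; exists (x ^+ 2 + 23 * y ^+ 2); rewrite mp xE yE; ring.
rewrite dvdzE abszX abszM /= Gauss_dvdr; last first.
  by rewrite coprime_pexpl // prime_coprime.
move=> lp; have : (l %| p)%N by apply: dvdn_trans lp; rewrite dvdn_exp.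
rewrite dvdn_prime2 // => /eqP lp'; move: lp; rewrite lp' => /dvdn_leq.
rewrite prime_gt0 // => /(_ isT); rewrite leqNgt -{1}[p]expn1 ltn_exp2l //.
exact: prime_gt1.
Qed.

Lemma form23_pndvdY (p m : nat) (X Y : int) : prime p -> ~~ (p %| m)%N ->
  m%:Z * p%:Z = X ^+ 2 + 23 * Y ^+ 2 -> ~~ (p %| Y)%Z.
Proof.
move=> p_prime pm mp; apply/negP => pY.
apply: (form23_coprime p_prime p_prime pm mp) => //.
apply: (@dvdzXn_prime p X 2 p_prime).
have -> : X ^+ 2 = m%:Z * p%:Z - Y * (23 * Y) by rewrite mp; ring.
by rewrite rpredB ?dvdz_mull // dvdz_mulr.
Qed.

Lemma coprimez_form27 (c X Y : int) : ~~ (3 %| X)%Z ->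
    (forall l, prime l -> (l %| X)%Z -> (l %| Y)%Z -> False) ->
  coprimez X (c * X ^+ 2 + 27 * Y ^+ 2).
Proof.
move=> X3 co; apply: coprimez_primes => [|l l_prime lX lN].
  by apply/orP; left; apply: contraNneq X3 => ->; rewrite dvdz0.
have : (l %| 27 * Y ^+ 2)%Z.
  have -> : 27 * Y ^+ 2 = c * X ^+ 2 + 27 * Y ^+ 2 - X * (c * X) by ring.
  by rewrite rpredB // dvdz_mulr.
rewrite dvdzM_prime // => /orP[|/(dvdzXn_prime l_prime)]; last exact: co.
rewrite -[27]/(3%:Z ^+ 3) => /(dvdzXn_prime l_prime).
rewrite dvdzE /= dvdn_prime2 // => /eqP l3.
by move: X3; rewrite -[3]/(3%N%:Z) -l3 lX.
Qed.

Section SymbolRelations.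

Variables (a b : int) (e : int -> nat).
Hypothesis abe : cubic_symbol a b e.
Let N := eisnorm a b.

(** Modulo N, k^3 M equals (-1)^3 j^2, and cubes have trivial symbol. *)
Lemma cubic_symbol_eq_sqr k j M : coprimez k N -> coprimez j N -> coprimez M N ->
  (N %| k ^+ 3 * M + j ^+ 2)%Z -> (3 %| e j)%N -> (3 %| e M)%N.
Proof.
move=> kN jN MN NE ej.
have c1 : coprimez (-1) N by rewrite coprimeNz coprimezE coprime1n.
have j2N : coprimez (j ^+ 2) N by rewrite coprimezXl.
rewrite /dvdn -(cubic_symbol_cubeM abe kN MN).
have -> : (e (k ^+ 3 * M) = e ((-1) ^+ 3 * j ^+ 2) %[mod 3])%N.
  apply: (cubic_symbol_mod abe); first by rewrite coprimezMl coprimezXl.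
  by rewrite (_ : _ - _ = k ^+ 3 * M + j ^+ 2) //; ring.
by rewrite (cubic_symbol_cubeM abe) // -/(dvdn _ _) (cubic_symbol_sqr abe).
Qed.

(** X has trivial symbol because it divides the trace, and 3^3 Y^2 = - X^2 modulo N passes this on
    to Y^2, hence to Y. *)
Lemma cubic_symbol_form27 X Y : ~~ (3 %| X)%Z -> coprimez 3 N ->
    (forall l, prime l -> (l %| X)%Z -> (l %| Y)%Z -> False) ->
    (X %| 2 * a - b)%Z -> (N %| X ^+ 2 + 27 * Y ^+ 2)%Z ->
  coprimez Y N /\ (3 %| e Y)%N.
Proof.
move=> X3 N3 co XT NE.
have XN : coprimez X N.
  by apply: (coprimez_dvdr NE); rewrite -[X ^+ 2]mul1r; apply: coprimez_form27.
have X0 : X != 0 by apply: contraNneq X3 => ->; rewrite dvdz0.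
have YN : coprimez Y N.
  apply: (coprimez_dvdr NE).
  apply: coprimez_primes => [|l lp lY lN].
    have Y2 := sqr_ge0 Y; have X2 : 0 < X ^+ 2 by rewrite exprn_even_gt0.
    by apply/orP; right; move: Y2 X2; clear; lia.
  apply: (co l) => //; apply: (@dvdzXn_prime l X 2 lp).
  have -> : X ^+ 2 = X ^+ 2 + 27 * Y ^+ 2 - Y * (27 * Y) by ring.
  by rewrite rpredB // dvdz_mulr.
split=> //; have eX := cubic_symbol_trace abe X3 XN XT.
rewrite -(cubic_symbol_sqr abe) //; apply: (@cubic_symbol_eq_sqr 3 X) => //.
  by rewrite coprimezXl.
by rewrite (_ : _ + _ = X ^+ 2 + 27 * Y ^+ 2) //; ring.
Qed.

Lemma cubic_symbol_half (M : int) : coprimez 2 N -> coprimez M N ->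
  ~~ (2 %| b)%Z -> (3 %| e (2 * M))%N -> ~~ (3 %| e M)%N.
Proof.
move=> N2 MN /(cubic_symbol_two abe) e2 e2M; apply: contra e2 => eM.
rewrite /dvdn (cubic_symbolM abe) // in e2M.
by move: eM e2M; clear; lia.
Qed.

End SymbolRelations.

Section PrincipalForm.

Variables (p : nat) (X Y : int).
Hypotheses (p_prime : prime p) (p2 : p != 2%N) (p3 : p != 3%N).
Hypothesis pE : p%:Z = X ^+ 2 + 23 * Y ^+ 2.

Let p_odd : ~~ (2 %| p)%N. Proof. by rewrite dvdn_prime2 // eq_sym. Qed.

Let pY : ~~ (p %| Y)%Z.
Proof.
apply: (@form23_pndvdY p 1 X Y) => //; last by rewrite mul1r.
by rewrite dvdn1; case: p p_prime => [|[]].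
Qed.

Let coXY l : prime l -> (l %| X)%Z -> (l %| Y)%Z -> False.
Proof.
move=> l_prime; apply: (@form23_coprime p 1 l X Y) => //; last by rewrite mul1r.
by rewrite dvdn1; case: l l_prime => [|[]].
Qed.

Let coprime_p (M : int) : (p %| M - 4 * Y ^+ 2)%Z -> coprimez p M.
Proof.
move=> pM; rewrite coprimez_prime //; apply: contra pY => pM'.
have : (p %| 4 * Y ^+ 2)%Z.
  have -> : 4 * Y ^+ 2 = M - (M - 4 * Y ^+ 2) by ring.
  by rewrite rpredB.
rewrite dvdzM_prime // => /orP[|/(dvdzXn_prime p_prime)//].
rewrite -[4]/(2%:Z ^+ 2) => /(dvdzXn_prime p_prime).
by rewrite dvdzE /= dvdn_prime2 // (negbTE p2).
Qed.

(** Here z = X - 3 c Y has trace 2 X and norm X^2 + 27 Y^2 = p + (2 Y)^2. The symbol of 2 is trivial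
    since 2 divides the trace. *)
Lemma principal_form_symbolA : ~~ (3 %| X)%Z ->
  exists2 e, cubic_symbol (X - 3 * Y) (- 6 * Y) e &
    coprimez p (eisnorm (X - 3 * Y) (- 6 * Y)) /\ (3 %| e p)%N.
Proof.
move=> X3; have b3 : (3 %| - 6 * Y)%Z by lia.
have a3 : ~~ (3 %| X - 3 * Y)%Z by lia.
have [e abe] := exists_cubic_symbol b3 a3; exists e => //.
set N := eisnorm _ _.
have NE1 : N = X ^+ 2 + 27 * Y ^+ 2 by rewrite /N /eisnorm; ring.
have NE2 : N = p%:Z + 4 * Y ^+ 2 by rewrite NE1 pE; ring.
have N3 : coprimez 3%N N by rewrite coprimez_prime // eisnorm_primary.
have N2 : coprimez 2%N N.
  by rewrite coprimez_prime // NE2; move: p_odd; clear; lia.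
have pN : coprimez p N by apply: coprime_p; rewrite NE2 addrK.
split=> //.
have [YN eY] : coprimez Y N /\ (3 %| e Y)%N.
  apply: (cubic_symbol_form27 abe X3) => //; last by rewrite -/N NE1.
  by apply/dvdzP; exists 2; ring.
have e2 : (3 %| e 2)%N.
  by apply: (cubic_symbol_trace_prime abe (isT : prime 2)) => //; lia.
apply: (cubic_symbol_eq_sqr abe (k := 1) (j := 2 * Y)) => //.
- by rewrite coprimezE coprime1n.
- by rewrite coprimezMl N2.
- by rewrite -/N NE2 (_ : _ + (2 * Y) ^+ 2 = p%:Z + 4 * Y ^+ 2) //; ring.
- by rewrite /dvdn (cubic_symbolM abe) // -/(dvdn _ _) dvdn_add.
Qed.

(** Here z = 25 Y + 3 c X has trace 50 Y and norm 625 Y^2 + 27 X^2 = 3^3 p + (2 Y)^2, so both 2 and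
    Y divide the trace. *)
Lemma principal_form_symbolB : (3 %| X)%Z ->
  exists2 e, cubic_symbol (25 * Y + 3 * X) (6 * X) e &
    coprimez p (eisnorm (25 * Y + 3 * X) (6 * X)) /\ (3 %| e p)%N.
Proof.
move=> X3; have b3 : (3 %| 6 * X)%Z by lia.
have Y3 : ~~ (3 %| Y)%Z by apply/negP; apply: (coXY (isT : prime 3)).
have a3 : ~~ (3 %| 25 * Y + 3 * X)%Z by lia.
have [e abe] := exists_cubic_symbol b3 a3; exists e => //.
set N := eisnorm _ _.
have NE1 : N = 625 * Y ^+ 2 + 27 * X ^+ 2 by rewrite /N /eisnorm; ring.
have NE2 : N = 27 * p%:Z + 4 * Y ^+ 2 by rewrite NE1 pE; ring.
have N3 : coprimez 3%N N by rewrite coprimez_prime // eisnorm_primary.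
have N2 : coprimez 2%N N.
  by rewrite coprimez_prime // NE2; move: p_odd; clear; lia.
have pN : coprimez p N by apply: coprime_p; rewrite NE2 addrK dvdz_mull.
split=> //.
have YN : coprimez Y N.
  by rewrite NE1; apply: coprimez_form27 => // l lp lY lX; apply: coXY lX lY.
have eY : (3 %| e Y)%N.
  by apply: (cubic_symbol_trace abe Y3 YN); apply/dvdzP; exists 50; ring.
have e2 : (3 %| e 2)%N.
  by apply: (cubic_symbol_trace_prime abe (isT : prime 2)) => //; lia.
apply: (cubic_symbol_eq_sqr abe (k := 3) (j := 2 * Y)) => //.
- by rewrite coprimezMl N2.
- by rewrite -/N NE2 (_ : _ + (2 * Y) ^+ 2 = 27 * p%:Z + 4 * Y ^+ 2) //; ring.
- by rewrite /dvdn (cubic_symbolM abe) // -/(dvdn _ _) dvdn_add.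
Qed.

End PrincipalForm.

Section NonPrincipalForm.

Variables (p : nat) (x y : int).
Hypotheses (p_prime : prime p) (p2 : p != 2%N) (p3 : p != 3%N).
Hypothesis pE : p%:Z = 2 * x ^+ 2 + x * y + 3 * y ^+ 2.

Let X := 4 * x + y.

Let p8 : 8%N%:Z * p%:Z = X ^+ 2 + 23 * y ^+ 2.
Proof. by rewrite pE /X; ring. Qed.

Let p_odd : ~~ (2 %| p)%N. Proof. by rewrite dvdn_prime2 // eq_sym. Qed.

Let y_odd : ~~ (2 %| y)%Z.
Proof.
apply: contra p_odd => /dvdzP[c yE].
have : p%:Z = 2 * (x ^+ 2 + x * c + 6 * c ^+ 2) by rewrite pE yE; ring.
by clear; lia.
Qed.

Let y2_odd : ~~ (2 %| y ^+ 2)%Z.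
Proof.
apply: contra y_odd; rewrite -[2 : int]/(2%N%:Z).
exact: (dvdzXn_prime (isT : prime 2)).
Qed.

Let p_y : ~~ (p %| y)%Z.
Proof.
apply: (@form23_pndvdY p 8 X y) => //.
by rewrite -[8%N]/(2 ^ 3)%N Euclid_dvdX // dvdn_prime2 // negb_and p2.
Qed.

Let coXy l : prime l -> (l %| X)%Z -> (l %| y)%Z -> False.
Proof.
move=> l_prime; have [->|l2 lX ly] := eqVneq l 2%N.
  by move=> _ y2; case/negP: y_odd.
apply: (@form23_coprime p 8 l X y) => //.
by rewrite -[8%N]/(2 ^ 3)%N Euclid_dvdX // dvdn_prime2 // negb_and l2.
Qed.

Let coprime_p (M : int) : (p %| M - y ^+ 2)%Z -> coprimez p M.
Proof.
move=> pM; rewrite coprimez_prime //; apply: contra p_y => pM'.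
apply: (@dvdzXn_prime p y 2 p_prime).
have -> : y ^+ 2 = M - (M - y ^+ 2) by ring.
by rewrite rpredB.
Qed.

(** Here z = (X - 3 c y) / 2 has trace X, and its norm 2 p + y^2 is a quarter of X^2 + 27 y^2. So 2
    p has trivial symbol while 2, as y is odd, does not. *)
Lemma nonprincipal_form_symbolA : ~~ (3 %| X)%Z ->
  exists2 e, cubic_symbol (2 * x - y) (- 3 * y) e &
    coprimez p (eisnorm (2 * x - y) (- 3 * y)) /\ ~~ (3 %| e p)%N.
Proof.
move=> X3; have b3 : (3 %| - 3 * y)%Z by lia.
have a3 : ~~ (3 %| 2 * x - y)%Z by move: X3; rewrite /X; clear; lia.
have [e abe] := exists_cubic_symbol b3 a3; exists e => //.
set N := eisnorm _ _.
have NE : N = 2 * p%:Z + y ^+ 2 by rewrite /N pE /eisnorm; ring.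
have N3 : coprimez 3%N N by rewrite coprimez_prime // eisnorm_primary.
have N2 : coprimez 2%N N.
  by rewrite coprimez_prime // NE; move: y2_odd; clear; lia.
have pN : coprimez p N by apply: coprime_p; rewrite NE addrK dvdz_mull.
split=> //.
have [yN ey] : coprimez y N /\ (3 %| e y)%N.
  apply: (cubic_symbol_form27 abe X3) => //.
    by apply/dvdzP; exists 1; rewrite /X; ring.
  by apply/dvdzP; exists 4; rewrite -/N NE pE /X; ring.
apply: (cubic_symbol_half abe) => //; first by move: y_odd; clear; lia.
apply: (cubic_symbol_eq_sqr abe (k := 1) (j := y)) => //.
- by rewrite coprimezE coprime1n.
- by rewrite coprimezMl N2.
- by rewrite -/N NE (_ : _ * _ + _ = 2 * p%:Z + y ^+ 2) //; ring.
Qed.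

(** Here z = (25 y + 3 c X) / 2 has trace 25 y and norm 3^3 (2 p) + y^2; again 2 p has trivial
    symbol and 2 does not. *)
Lemma nonprincipal_form_symbolB : (3 %| X)%Z ->
  exists2 e, cubic_symbol (6 * x + 14 * y) (3 * X) e &
    coprimez p (eisnorm (6 * x + 14 * y) (3 * X)) /\ ~~ (3 %| e p)%N.
Proof.
move=> X3; have b3 : (3 %| 3 * X)%Z by lia.
have y3 : ~~ (3 %| y)%Z by apply/negP; apply: (coXy (isT : prime 3)).
have a3 : ~~ (3 %| 6 * x + 14 * y)%Z by move: y3; clear; lia.
have [e abe] := exists_cubic_symbol b3 a3; exists e => //.
set N := eisnorm _ _.
have NE : N = 54 * p%:Z + y ^+ 2 by rewrite /N pE /eisnorm /X; ring.
have N3 : coprimez 3%N N by rewrite coprimez_prime // eisnorm_primary.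
have N2 : coprimez 2%N N.
  by rewrite coprimez_prime // NE; move: y2_odd; clear; lia.
have pN : coprimez p N by apply: coprime_p; rewrite NE addrK dvdz_mull.
split=> //.
have yN : coprimez y N.
  have ND : (N %| 625 * y ^+ 2 + 27 * X ^+ 2)%Z.
    by apply/dvdzP; exists 4; rewrite NE pE /X; ring.
  apply: (coprimez_dvdr ND).
  by apply: coprimez_form27 => // l lp ly lX; apply: coXy lX ly.
have ey : (3 %| e y)%N.
  apply: (cubic_symbol_trace abe y3 yN).
  by apply/dvdzP; exists 25; rewrite /X; ring.
apply: (cubic_symbol_half abe) => //; first by move: y_odd; rewrite /X; clear; lia.
apply: (cubic_symbol_eq_sqr abe (k := 3) (j := y)) => //.
- by rewrite coprimezMl N2.
- by rewrite -/N NE (_ : _ * _ + _ = 54 * p%:Z + y ^+ 2) //; ring.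
Qed.

End NonPrincipalForm.

(** * The cubic resolvent *)

Section CubicResolvent.

Variables (K : closedFieldType) (p : nat) (w s : K).
Hypotheses (p_prime : prime p) (pK : p \in [pchar K]).
Hypotheses (p2 : p != 2%N) (p3 : p != 3%N) (p23 : p != 23%N).
Hypotheses (wE : w ^+ 2 = - w - 1) (s2 : s ^+ 2 = - 23%:R).

Let K2 : 2%:R != 0 :> K. Proof. by rewrite -(dvdn_pcharf pK) dvdn_prime2. Qed.
Let K3 : 3%:R != 0 :> K. Proof. by rewrite -(dvdn_pcharf pK) dvdn_prime2. Qed.
Let K23 : 23%:R != 0 :> K. Proof. by rewrite -(dvdn_pcharf pK) dvdn_prime2. Qed.

Let c : K := 1 + 2%:R * w.

Let cE : c ^+ 2 = - 3%:R. Proof. by rewrite /c; ring: wE. Qed.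

(** The value of u^3 in Cardano's formula: a root of t^2 - t + 1/27, whose other root has - c s in
    place of c s. *)
Definition resolvent : K := (9%:R + c * s) / 18%:R.

Let K18 : 18%:R != 0 :> K.
Proof. by rewrite (_ : 18 = 2 * 3 * 3)%N // !natrM !mulf_neq0. Qed.

Lemma cardano : exists u v : K,
  [/\ u ^+ 3 = resolvent, 3%:R * u * v = 1 & v ^+ 3 = (9%:R - c * s) / 18%:R].
Proof.
have /closed_rootP[u] : size ('X^3 - resolvent%:P) != 1%N by rewrite size_XnsubC.
rewrite rootE !hornerE subr_eq0 => /eqP u3.
have norm : 27%:R * resolvent * ((9%:R - c * s) / 18%:R) = 1.
  by rewrite /resolvent; field: cE s2.
have u0 : u != 0.
  apply: contra_eq_neq norm => u0; rewrite -u3 u0 expr0n /= mulr0 mul0r.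
  by rewrite eq_sym oner_eq0.
have uv : 3%:R * u * (3%:R * u)^-1 = 1 by rewrite divff // mulf_neq0.
exists u, (3%:R * u)^-1; split=> //; move: uv; move: (_ ^-1) => v uv.
have uv3 : 27%:R * u ^+ 3 * v ^+ 3 = 1.
  have -> : 27%:R * u ^+ 3 * v ^+ 3 = (3%:R * u * v) ^+ 3 by ring.
  by rewrite uv expr1n.
 apply: (mulfI (_ : 27%:R * u ^+ 3 != 0)).
  by apply: contra_eq_neq uv3 => ->; rewrite mul0r eq_sym oner_eq0.
by rewrite uv3 u3 norm.
Qed.

Lemma cubic_factor u v x :
    u ^+ 3 = resolvent -> 3%:R * u * v = 1 -> v ^+ 3 = (9%:R - c * s) / 18%:R ->
  x ^+ 3 - x - 1 =
  (x - (u + v)) * (x - (w * u + w ^+ 2 * v)) * (x - (w ^+ 2 * u + w * v)).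
Proof.
move=> u3 uv v3.
have -> : (x - (u + v)) * (x - (w * u + w ^+ 2 * v)) * (x - (w ^+ 2 * u + w * v))
   = x ^+ 3 - 3%:R * u * v * x - (u ^+ 3 + v ^+ 3) by ring: wE.
by rewrite uv u3 v3 /resolvent; field.
Qed.

Hypothesis sp : s ^+ p = s.

Definition Frob2 : {rmorphism K -> K} :=
  (pFrobenius_aut pK \o pFrobenius_aut pK)%FUN.

Lemma Frob2E x : Frob2 x = x ^+ (p ^ 2).
Proof. by rewrite /= !pFrobenius_autE -exprM expnS expn1. Qed.

Lemma Frob2_fixed x : x ^+ p = x -> Frob2 x = x.
Proof. by move=> xp; rewrite Frob2E expnS expn1 exprM !xp. Qed.

Let M := ((p ^ 2).-1 %/ 3)%N.

Let Fw : Frob2 w = w. Proof. by rewrite Frob2E omega_Frobenius2. Qed.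

Let Fc : Frob2 c = c.
Proof. by rewrite rmorphD rmorphM rmorph1 rmorph_nat Fw. Qed.

Let Fs : Frob2 s = s. Proof. exact: Frob2_fixed. Qed.

Lemma Frob2_cube x : x != 0 -> Frob2 x = x -> (x ^+ 3) ^+ M = 1.
Proof.
move=> x0; rewrite Frob2E => xp; rewrite -exprM mulnC divn3_sqr //.
by rewrite Frobenius2_fixed ?prime_gt0.
Qed.

(* [(p^2 - 1) / 3]-th powers detect the cubes of F_(p^2), and an irreducible cubic
   over F_p has no root in F_(p^2). *)
Lemma cubic_root_criterion :
  (exists2 x : K, x ^+ p = x & x ^+ 3 - x - 1 = 0) <-> resolvent ^+ M = 1.
Proof.
have [u [v [u3 uv v3]]] := cardano.
have u0 : u != 0.
  by apply: contra_eq_neq uv => ->; rewrite mulr0 mul0r eq_sym oner_eq0.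
split=> [[x xp xE]|].
  (* Multiplying u by a cube root of unity and v by its inverse brings any root to the form u1 +
     v1. *)
  have [u1 [v1 [u13 uv1 v13 xE1]]] : exists u1 v1, [/\ u1 ^+ 3 = resolvent,
      3%:R * u1 * v1 = 1, v1 ^+ 3 = (9%:R - c * s) / 18%:R & x = u1 + v1].
    move/eqP: xE; rewrite (cubic_factor _ u3 uv v3) !mulf_eq0 !subr_eq0.
    case/orP=> [/orP[]|] /eqP->; first by exists u, v.
      exists (w * u), (w ^+ 2 * v); split=> //;
        [rewrite -[RHS]u3|rewrite -[RHS]uv|rewrite -[RHS]v3]; ring: wE.
    exists (w ^+ 2 * u), (w * v); split=> //;
      [rewrite -[RHS]u3|rewrite -[RHS]uv|rewrite -[RHS]v3]; ring: wE.
  (* This expresses u1 - v1 through x, c and s, which are all fixed by [Frob2]; so u1 lies in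
     F_(p^2). *)
  have d3 : (u1 - v1) * (3%:R * x ^+ 2 - 1) * 3%:R = c * s.
    have -> : (u1 - v1) * (3%:R * x ^+ 2 - 1) * 3%:R =
      9%:R * (u1 ^+ 3 - v1 ^+ 3) + (3%:R * u1 * v1 - 1) * (u1 - v1) * 3%:R.
      by rewrite xE1; ring.
    by rewrite uv1 u13 v13 /resolvent; field.
  have cs0 : c * s != 0.
    rewrite mulf_neq0 //; [apply: contra_eq_neq cE | apply: contra_eq_neq s2] => ->.
      by rewrite expr0n eq_sym oppr_eq0.
    by rewrite expr0n eq_sym oppr_eq0.
  have x0 : 3%:R * x ^+ 2 - 1 != 0.
    by apply: contra_neq cs0 => x0; rewrite -d3 x0 mulr0 mul0r.
  have Fd : Frob2 (u1 - v1) = u1 - v1.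
    apply: (mulIf x0); apply: (mulIf K3); rewrite d3.
    rewrite -[in RHS]Fc -[in RHS]Fs -rmorphM -d3 !rmorphM rmorph_nat.
    congr (_ * _ * _).
    by rewrite rmorphB rmorphM rmorphXn rmorph1 rmorph_nat (Frob2_fixed xp).
  have Fu : Frob2 u1 = u1.
    apply: (mulfI K2); rewrite -[X in X * _](rmorph_nat Frob2) -rmorphM.
    have -> : 2%:R * u1 = x + (u1 - v1) by rewrite xE1; ring.
    by rewrite rmorphD Fd (Frob2_fixed xp).
  rewrite -u13 Frob2_cube //.
  by apply: contra_eq_neq uv1 => ->; rewrite mulr0 mul0r eq_sym oner_eq0.
rewrite -u3 -exprM mulnC divn3_sqr // => uM.
have Fu : Frob2 u = u.
  by rewrite Frob2E -[RHS]mul1r -uM -exprSr prednK // expn_gt0 prime_gt0.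
have vE : v = (3%:R * u)^-1.
  have u3n0 : 3%:R * u != 0 by rewrite mulf_neq0.
  by apply: (mulfI u3n0); rewrite divff.
have Fv : Frob2 v = v by rewrite vE fmorphV rmorphM Fu rmorph_nat.
pose x := u + v; have Fx : Frob2 x = x by rewrite rmorphD Fu Fv.
have xE : x ^+ 3 - x - 1 = 0 by rewrite (cubic_factor _ u3 uv v3) subrr !mul0r.
(* If x is not in F_p, its conjugate y = x^p is a second root, and the third root - (x + y) is fixed
   by Frobenius. *)
have [xp|xp] := eqVneq (x ^+ p) x; first by exists x.
pose y := x ^+ p; have yE : y ^+ 3 - y - 1 = 0.
  rewrite /y -(pFrobenius_autE pK) -rmorphXn -!rmorphB.
  by rewrite -(rmorph1 (pFrobenius_aut pK)) -rmorphB xE rmorph0.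
have yp : y ^+ p = x by move: Fx; rewrite Frob2E expnS expn1 exprM.
have e2 : x ^+ 2 + x * y + y ^+ 2 = 1.
  apply: (mulfI (_ : y - x != 0)); first by rewrite subr_eq0.
  apply/eqP; rewrite -subr_eq0; apply/eqP.
  have -> : (y - x) * (x ^+ 2 + x * y + y ^+ 2) - (y - x) * 1 =
     (y ^+ 3 - y - 1) - (x ^+ 3 - x - 1) by ring.
  by rewrite xE yE subrr.
exists (- (x + y)).
  have Frob (t t' : K) : (- (t + t')) ^+ p = - (t ^+ p + t' ^+ p).
    by rewrite -!(pFrobenius_autE pK) rmorphN rmorphD.
  by rewrite Frob -/y yp addrC.
have -> : (- (x + y)) ^+ 3 - - (x + y) - 1 = (x ^+ 3 - x - 1)
    - (2%:R * x + y) * (x ^+ 2 + x * y + y ^+ 2 - 1) by ring.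
by rewrite xE e2 subrr mulr0 subrr.
Qed.

(** Since s^2 - 9 c^2 = 4, the product (s - 3 c)^2 (s + 3 c) is 4 (s - 3 c), which is (2 c)^3 times
    the resolvent. *)
Lemma symbol_resolventA (y z z' : K) : y != 0 -> Frob2 y = y ->
    z = y * (s - 3%:R * c) -> z' = y * (s + 3%:R * c) ->
  (z ^+ 2 * z') ^+ M = resolvent ^+ M.
Proof.
move=> y0 Fy -> ->.
have -> : (y * (s - 3%:R * c)) ^+ 2 * (y * (s + 3%:R * c)) =
    resolvent * (2%:R * c * y) ^+ 3 by rewrite /resolvent; field: cE s2.
rewrite exprMn Frob2_cube ?mulr1 //.
  rewrite !mulf_neq0 //; apply: contra_eq_neq cE => ->.
  by rewrite expr0n eq_sym oppr_eq0.
by rewrite !rmorphM rmorph_nat Fc Fy.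
Qed.

(* (25 + 3 c s) / 2 is the fundamental unit of Q(sqrt 69); it is a rational
   multiple of the square of the resolvent. *)
Lemma symbol_resolventB (y z z' : K) : y != 0 -> Frob2 y = y ->
    z = y * (25%:R + 3%:R * c * s) -> z' = y * (25%:R - 3%:R * c * s) ->
  (z ^+ 2 * z') ^+ M = (resolvent ^+ M) ^+ 2.
Proof.
move=> y0 Fy -> ->.
have -> : (y * (25%:R + 3%:R * c * s)) ^+ 2 * (y * (25%:R - 3%:R * c * s)) =
    resolvent ^+ 2 * (2%:R * 3%:R * y) ^+ 3 by rewrite /resolvent; field: cE s2.
rewrite exprMn Frob2_cube ?mulr1 1?exprAC //; first by rewrite !mulf_neq0.
by rewrite !rmorphM !rmorph_nat Fy.
Qed.

Lemma resolvent_cube : resolvent ^+ M ^+ 3 = 1.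
Proof.
rewrite exprAC Frob2_cube //.
  have : 27%:R * resolvent * ((9%:R - c * s) / 18%:R) = 1.
    by rewrite /resolvent; field: cE s2.
  by apply: contra_eq_neq => ->; rewrite mulr0 mul0r eq_sym oner_eq0.
by rewrite rmorphM fmorphV rmorphD rmorphM !rmorph_nat Fc Fs.
Qed.

End CubicResolvent.

(** X^p - X is the product of the X - y over y in F_p. *)
Lemma fixed_by_Frobenius p (K : fieldType) (f : {rmorphism 'F_p -> K}) x :
  prime p -> x ^+ p = x -> exists y, x = f y.
Proof.
move=> p_prime xp.
have := congr1 (horner^~ x \o map_poly f) (finField_genPoly 'F_p).
rewrite /= card_Fp // rmorphB /= map_polyXn map_polyX !hornerE xp subrr.
rewrite rmorph_prod horner_prod => /esym/eqP; rewrite prodf_seq_eq0 => /hasP[y _].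
rewrite rmorphB /= map_polyX map_polyC !hornerE subr_eq0 => /eqP ->.
by exists y.
Qed.

Lemma Fp_Frobenius p (x : 'F_p) : prime p -> x ^+ p = x.
Proof. by move=> p_prime; rewrite -[RHS]expf_card card_Fp. Qed.

(** * Roots of t^3 - t - 1 modulo p, according to the form representing p *)

Section ResidueConditions.

Variables (p : nat).
Hypotheses (p_prime : prime p) (p2 : p != 2%N) (p3 : p != 3%N) (p23 : p != 23%N).

Definition has_root := exists x : 'F_p, x ^+ 3 - x - 1 = 0.

Section Closure.

Variables (K : closedFieldType) (f : {rmorphism 'F_p -> K}).
Let pK : p \in [pchar K] := pchar_closure f p_prime.

Lemma has_rootP :
  has_root <-> exists2 x : K, x ^+ p = x & x ^+ 3 - x - 1 = 0.
Proof.
split=> [[x xE]|[x xp]].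
  exists (f x); first by rewrite -rmorphXn Fp_Frobenius.
  by rewrite -rmorphXn -!rmorphB -(rmorph1 f) -rmorphB xE rmorph0.
have [y ->] := fixed_by_Frobenius f p_prime xp => /eqP.
rewrite -rmorphXn -(rmorph1 f) -!rmorphB fmorph_eq0 => /eqP yE.
by exists y.
Qed.

Lemma intr_closure_Frobenius (n : int) : (n%:~R : K) ^+ p = n%:~R.
Proof. exact: intr_Frobenius. Qed.

Lemma ratio_sqrt (m : nat) (X Y : int) : ~~ (p %| Y)%Z ->
    m%:Z * p%:Z = X ^+ 2 + 23 * Y ^+ 2 ->
  exists s : K, [/\ s ^+ 2 = - 23%:R, s ^+ p = s & X%:~R = s * Y%:~R].
Proof.
rewrite (dvdz_pcharf pK) => Y0 mp; exists (X%:~R / Y%:~R); split.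
- have : (X ^+ 2 + 23 * Y ^+ 2)%:~R = 0 :> K.
    by apply/eqP; rewrite -(dvdz_pcharf pK) -mp dvdz_mull.
  rewrite rmorphD rmorphM !rmorphXn /= => /eqP; rewrite addr_eq0 => /eqP X2.
  by rewrite exprMn exprVn X2 -mulNr mulfK ?expf_neq0.
- by rewrite exprMn exprVn !intr_closure_Frobenius.
- by rewrite divfK.
Qed.

End Closure.

Lemma principal_form_root (X Y : int) :
  p%:Z = X ^+ 2 + 23 * Y ^+ 2 -> has_root.
Proof.
move=> pE; have [K [f]] := exists_Fp_closure p.
have pK := pchar_closure f p_prime.
have K3 := pchar_three p_prime p3 pK; have [w wE] := exists_omega K3.
have p1 : 1%N%:Z * p%:Z = X ^+ 2 + 23 * Y ^+ 2 by rewrite mul1r.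
have pn1 : ~~ (p %| 1)%N by rewrite dvdn1 gtn_eqF ?prime_gt1.
have pY := form23_pndvdY p_prime pn1 p1.
have [s [s2 sp XE]] := ratio_sqrt f pY p1.
have Y0 : Y%:~R != 0 :> K by rewrite -(dvdz_pcharf pK).
have FY : Frob2 pK Y%:~R = Y%:~R by rewrite rmorph_int.
apply/(has_rootP f)/(cubic_root_criterion p_prime pK p2 p3 p23 wE s2 sp).
have [X3|X3] := boolP (3 %| X)%Z; last first.
  have [e abe [pN ep]] := principal_form_symbolA p_prime p2 p3 pE X3.
  rewrite -(symbol_resolventA p_prime p2 p3 wE s2 Y0 FY (erefl _) (erefl _)).
  transitivity (w ^+ e p); last by apply/eqP; rewrite omega_exp_eq1.
  rewrite -(cubic_symbol_prime abe wE p_prime p3 pN pK); congr (_ ^+ _).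
  rewrite /eisval !rmorphB !rmorphM /= XE.
  by ring: wE.
have [e abe [pN ep]] := principal_form_symbolB p_prime p2 p3 pE X3.
have := symbol_resolventB p_prime p2 p3 wE s2 Y0 FY (erefl _) (erefl _).
have -> : (Y%:~R * (25%:R + 3%:R * (1 + 2%:R * w) * s)) ^+ 2 *
    (Y%:~R * (25%:R - 3%:R * (1 + 2%:R * w) * s)) =
    eisval w (25 * Y + 3 * X) (6 * X) ^+ 2
    * eisval (w ^+ 2) (25 * Y + 3 * X) (6 * X).
  by rewrite /eisval !rmorphD !rmorphM /= XE; ring: wE.
rewrite (cubic_symbol_prime abe wE p_prime p3 pN pK).
(* Only the square of the resolvent's symbol is obtained as 1; its cube is also 1, which settles the
   symbol itself. *)
rewrite (eqP (_ : w ^+ e p == 1)) ?omega_exp_eq1 // => T2.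
have := resolvent_cube p_prime pK p2 p3 wE s2 sp.
by rewrite exprS -T2 mulr1.
Qed.

Lemma nonprincipal_form_root (x y : int) :
  p%:Z = 2 * x ^+ 2 + x * y + 3 * y ^+ 2 -> ~ has_root.
Proof.
move=> pE; have [K [f]] := exists_Fp_closure p.
have pK := pchar_closure f p_prime.
have K3 := pchar_three p_prime p3 pK; have [w wE] := exists_omega K3.
have p8 : 8%N%:Z * p%:Z = (4 * x + y) ^+ 2 + 23 * y ^+ 2 by rewrite pE; ring.
have pn8 : ~~ (p %| 8)%N.
  by rewrite -[8%N]/(2 ^ 3)%N Euclid_dvdX // dvdn_prime2 // negb_and p2.
have py := form23_pndvdY p_prime pn8 p8.
have [s [s2 sp XE]] := ratio_sqrt f py p8.
have K2 : 2%:R != 0 :> K by rewrite -(dvdn_pcharf pK) dvdn_prime2.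
(* The factor y / 2 comes from z = (X - 3 c y) / 2 = (y / 2) (s - 3 c). *)
have y0 : y%:~R / 2%:R != 0 :> K.
  by rewrite mulf_neq0 ?invr_eq0 // -(dvdz_pcharf pK).
have Fy : Frob2 pK (y%:~R / 2%:R) = y%:~R / 2%:R.
  by rewrite fmorph_div rmorph_int rmorph_nat.
have K4 : 4%:R != 0 :> K by rewrite (_ : 4 = 2 * 2)%N // natrM mulf_neq0.
have {}XE : x%:~R = (s - 1) * y%:~R / 4%:R :> K.
  apply: (mulfI K4); rewrite [RHS]mulrC divfK //.
  by rewrite mulrBl -XE mul1r rmorphD rmorphM /= addrK.
move/(has_rootP f)/(cubic_root_criterion p_prime pK p2 p3 p23 wE s2 sp) => T1.
have [X3|X3] := boolP (3 %| 4 * x + y)%Z; last first.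
  have [e abe [pN /negP[]]] := nonprincipal_form_symbolA p_prime p2 p3 pE X3.
  rewrite -(omega_exp_eq1 _ wE K3) -(cubic_symbol_prime abe wE p_prime p3 pN pK).
  rewrite -[X in _ == X]T1.
  rewrite -(symbol_resolventA p_prime p2 p3 wE s2 y0 Fy (erefl _) (erefl _)).
  apply/eqP; congr (_ ^+ _).
  by rewrite /eisval !rmorphB !rmorphM /= XE; field: wE; rewrite K2 K4.
have [e abe [pN /negP[]]] := nonprincipal_form_symbolB p_prime p2 p3 pE X3.
rewrite -(omega_exp_eq1 _ wE K3) -(cubic_symbol_prime abe wE p_prime p3 pN pK).
rewrite -[X in _ == X](expr1n _ 2) -[X in _ == X ^+ _]T1.
rewrite -(symbol_resolventB p_prime p2 p3 wE s2 y0 Fy (erefl _) (erefl _)).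
apply/eqP; congr (_ ^+ _).
rewrite /eisval !rmorphD !rmorphM !rmorphD !rmorphM /= XE.
by field: wE; rewrite K2 K4.
Qed.

End ResidueConditions.

(** * Reduction of forms of discriminant -23 *)

Definition represented (a b c a' b' c' : int) : Prop := forall m n : int,
  exists x y : int, a * m ^+ 2 + b * m * n + c * n ^+ 2
                    = a' * x ^+ 2 + b' * x * y + c' * y ^+ 2.

(** Gauss reduction: a translation brings the middle coefficient into [-a, a), and exchanging the
    outer coefficients lowers a as long as c1 < a. *)
Lemma form_reduction (a b c : int) : 0 < a -> b ^+ 2 - 4 * a * c = - 23 ->
  represented a b c 1 1 6 \/ represented a b c 2 1 3.
Proof.
have [n] := ubnP `|a|%N; elim: n a b c => // n IH a b c an a0 disc.
pose k := - ((b + a) %/ (2 * a))%Z.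
pose b1 := b + 2 * a * k; pose c1 := a * k ^+ 2 + b * k + c.
have a2 : 0 < 2 * a by lia.
have b1_lo : - a <= b1.
  have := modz_ge0 (b + a) (lt0r_neq0 a2); have := divz_eq (b + a) (2 * a).
  by rewrite /b1 /k; lia.
have b1_hi : b1 < a.
  have := ltz_pmod (b + a) a2; have := divz_eq (b + a) (2 * a).
  by rewrite /b1 /k; lia.
have disc1 : b1 ^+ 2 - 4 * a * c1 = - 23 by rewrite -disc /b1 /c1; ring.
have shift a' b' c' : represented a b1 c1 a' b' c' -> represented a b c a' b' c'.
  move=> rep m l; have [x [y e]] := rep (m - k * l) l.
  by exists x, y; rewrite -e /b1 /c1; ring.
have [c1a|ac1] := ltP c1 a.
  have swap a' b' c' : represented c1 b1 a a' b' c' -> represented a b1 c1 a' b' c'.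
    by move=> rep m l; have [x [y e]] := rep l m; exists x, y; rewrite -e; ring.
  have c10 : 0 < c1 by move: disc1 a0 (sqr_ge0 b1); clear; nia.
  have [||| r|r] := IH c1 b1 a; rewrite ?[c1 * _]mulrC; try by [].
  - by move: c1a c10 an; clear; lia.
  - by rewrite -disc1; ring.
  - by left; apply/shift/swap.
  - by right; apply/shift/swap.
(* For a reduced form, 4 a^2 <= 4 a c1 = b1^2 + 23 <= a^2 + 23. *)
have a7 : a ^+ 2 <= 7 by move: disc1 b1_lo b1_hi ac1 a0; clear; nia.
have a12 : (a == 1) || (a == 2) by move: a7 a0; clear; nia.
case/orP: a12 => /eqP aE.
  have b1E : b1 = - 1 by move: disc1 b1_lo b1_hi; rewrite aE; clear; lia.
  have c1E : c1 = 6 by move: disc1; rewrite aE b1E; clear; lia.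
  left; apply: shift; rewrite aE b1E c1E => m l.
  by exists (- m), l; ring.
have b1E : (b1 == 1) || (b1 == - 1).
  have : (b1 == -2) || (b1 == -1) || (b1 == 0) || (b1 == 1).
    by move: b1_lo b1_hi; rewrite aE; clear; lia.
  by case/orP => [/orP[/orP[]|]|] /eqP bE; move: disc1; rewrite aE bE; clear; lia.
right; apply: shift; rewrite aE.
case/orP: b1E => /eqP b1E.
  have -> : c1 = 3 by move: disc1; rewrite aE b1E; clear; lia.
  by rewrite b1E => m l; exists m, l.
have -> : c1 = 3 by move: disc1; rewrite aE b1E; clear; lia.
by rewrite b1E => m l; exists (- m), l; ring.
Qed.

Lemma legendre_eq1 (a : int) p : prime p -> ~~ (p %| a)%Z ->
  legendre a p = 1 <-> exists t : 'F_p, t ^+ 2 = a%:~R.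
Proof.
move=> p_prime pa; rewrite /legendre (negbTE pa).
case: existsP => [[t /eqP tE]|no]; first by split=> // _; exists t.
by split=> // [[t tE]]; case: no; exists t; apply/eqP.
Qed.

Lemma natr_pchar_modn (R : nzRingType) p m n : p \in [pchar R] ->
  m = n %[mod p] <-> m%:R = n%:R :> R.
Proof.
move=> pR; wlog le_nm : m n / (n <= m)%N.
  case: (leqP n m) => [/[swap]/[apply]//|/ltnW nm /(_ n m nm) e].
  by split=> /esym/e/esym.
have mod_eq : (m == n %[mod p]) = (m%:R == n%:R :> R).
  by rewrite eqn_mod_dvd // (dvdn_pcharf pR) natrB // subr_eq0.
by split=> /eqP; [rewrite mod_eq => /eqP|rewrite -mod_eq => /eqP].
Qed.

(** * The Perrin sequence modulo p *)

Section Perrin.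

Variables (K : fieldType) (x y z : K).
Hypotheses (e1 : x + y + z = 0) (e2 : x * y + y * z + z * x = -1).
Hypothesis e3 : x * y * z = 1.

Lemma perrin_root t : t ^+ 3 - t - 1 = (t - x) * (t - y) * (t - z).
Proof.
have -> : (t - x) * (t - y) * (t - z) =
  t ^+ 3 - (x + y + z) * t ^+ 2 + (x * y + y * z + z * x) * t - x * y * z by ring.
by rewrite e1 e2 e3; ring.
Qed.

Lemma perrin_power_sum n : (perrin n)%:R = x ^+ n + y ^+ n + z ^+ n.
Proof.
have rec (t : K) : t ^+ 3 - t - 1 = 0 -> forall n, t ^+ n.+3 = t ^+ n.+1 + t ^+ n.
  move=> tE m; apply/eqP; rewrite -subr_eq0 -[X in _ == X](mulr0 (t ^+ m)) -tE.
  by apply/eqP; rewrite !exprS; ring.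
have xr := rec x; have yr := rec y; have zr := rec z.
rewrite !perrin_root !subrr !(mul0r, mulr0) in xr yr zr.
suff: (perrin n)%:R = x ^+ n + y ^+ n + z ^+ n /\
      (perrin n.+1)%:R = x ^+ n.+1 + y ^+ n.+1 + z ^+ n.+1 /\
      (perrin n.+2)%:R = x ^+ n.+2 + y ^+ n.+2 + z ^+ n.+2 by case.
elim: n => [|n [IH0 [IH1 IH2]]].
  rewrite !expr0 !expr1 e1; do !split=> //; first by rewrite /=; ring.
  have -> : x ^+ 2 + y ^+ 2 + z ^+ 2 =
    (x + y + z) ^+ 2 - 2%:R * (x * y + y * z + z * x) by ring.
  by rewrite e1 e2 /=; ring.
do !split=> //; rewrite natrD IH0 IH1 xr // yr // zr //; ring.
Qed.

Lemma perrin_discriminant : ((x - y) * (y - z) * (z - x)) ^+ 2 = - 23%:R.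
Proof.
have zE : z = - (x + y) by apply/eqP; rewrite -addr_eq0 addrC e1.
have e2' : y ^+ 2 = 1 - x ^+ 2 - x * y.
  have -> : y ^+ 2 = - (x * y + y * z + z * x) - x ^+ 2 - x * y by rewrite zE; ring.
  by rewrite e2; ring.
have x3 : x ^+ 3 = x + 1.
  apply/eqP; rewrite -subr_eq0 opprD addrA; apply/eqP.
  by rewrite perrin_root subrr !mul0r.
by rewrite zE; ring: e2' x3.
Qed.

End Perrin.

Lemma perrin_roots (K : closedFieldType) : exists x y z : K,
  [/\ x + y + z = 0, x * y + y * z + z * x = -1 & x * y * z = 1].
Proof.
have /closed_rootP[x] : size ('X^3 - ('X + 1) : {poly K}) != 1%N.
  by rewrite size_polyDl ?size_polyXn // size_polyN size_XaddC.
rewrite rootE !hornerE subr_eq0 => /eqP x3.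
have /closed_rootP[y] :
    size ('X^2 + (x *: 'X + (x ^+ 2 - 1)%:P) : {poly K}) != 1%N.
  rewrite size_polyDl ?size_polyXn // (leq_ltn_trans (size_polyD _ _)) // gtn_max.
  rewrite (leq_ltn_trans (size_scale_leq _ _)) ?size_polyX //.
  by rewrite (leq_ltn_trans (size_polyC_leq1 _)).
rewrite rootE !hornerD hornerXn hornerZ hornerX hornerC => /eqP y2.
have {}y2 : y ^+ 2 = 1 - x ^+ 2 - x * y.
  by apply/eqP; rewrite -subr_eq0 -[X in _ == X]y2; apply/eqP; ring.
by exists x, y, (- (x + y)); split; ring: y2 x3.
Qed.

Section PerrinPrime.

Variables (p : nat).
Hypotheses (p_prime : prime p) (p2 : p != 2%N) (p3 : p != 3%N) (p23 : p != 23%N).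

Variables (K : closedFieldType) (f : {rmorphism 'F_p -> K}).
Let pK : p \in [pchar K] := pchar_closure f p_prime.
Let K2 : 2%:R != 0 :> K. Proof. by rewrite -(dvdn_pcharf pK) dvdn_prime2. Qed.
Let K3 : 3%:R != 0 :> K. Proof. by rewrite -(dvdn_pcharf pK) dvdn_prime2. Qed.
Let K23 : 23%:R != 0 :> K. Proof. by rewrite -(dvdn_pcharf pK) dvdn_prime2. Qed.

Section Roots.

Variables x y z : K.
Hypotheses (e1 : x + y + z = 0) (e2 : x * y + y * z + z * x = -1).
Hypothesis e3 : x * y * z = 1.

Lemma perrin_roots_uniq : [/\ x != y, y != z & z != x].
Proof.
have : (x - y) * (y - z) * (z - x) != 0.
  apply: contra_eq_neq (perrin_discriminant e1 e2 e3) => ->.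
  by rewrite expr0n eq_sym oppr_eq0.
by rewrite !mulf_eq0 !subr_eq0 !negb_or => /andP[/andP[]].
Qed.

Lemma Frobenius_root t : (t - x) * (t - y) * (t - z) = 0 ->
  [\/ t ^+ p = x, t ^+ p = y | t ^+ p = z].
Proof.
rewrite -(perrin_root e1 e2 e3) => tE.
have : (t ^+ p) ^+ 3 - t ^+ p - 1 = 0.
  rewrite -(pFrobenius_autE pK) -rmorphXn -(rmorph1 (pFrobenius_aut pK)).
  by rewrite -!rmorphB tE rmorph0.
rewrite (perrin_root e1 e2 e3) => /eqP; rewrite !mulf_eq0 !subr_eq0.
by case/orP => [/orP[]|] /eqP ?; [apply: Or31|apply: Or32|apply: Or33].
Qed.

Lemma Frobenius_inj (s t : K) : s ^+ p = t ^+ p -> s = t.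
Proof. by rewrite -!(pFrobenius_autE pK); apply: fmorph_inj. Qed.

(** Multiplied by x, the left-hand side becomes x^3 + 2 x y z = x + 3, so equality would give x = 3
    and then 23 = 0. *)
Lemma perrin_transposition_neq : x ^+ 2 + 2%:R * y * z <> 2%:R.
Proof.
have x3 : x ^+ 3 = x + 1.
  apply/eqP; rewrite -subr_eq0 opprD addrA; apply/eqP.
  by rewrite (perrin_root e1 e2 e3) subrr !mul0r.
move=> h; have : x = 3%:R.
  apply/eqP; rewrite -subr_eq0; apply/eqP.
  transitivity (x * 2%:R - x * (x ^+ 2 + 2%:R * y * z)); last by rewrite h subrr.
  have -> : x * (x ^+ 2 + 2%:R * y * z) = x ^+ 3 + 2%:R * (x * y * z) by ring.
  by rewrite e3 x3; ring.
move=> xE; move/eqP: K23; case; move: x3; rewrite xE => h3.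
have -> : 23%:R = 3%:R ^+ 3 - (3%:R + 1) :> K by ring.
by rewrite h3 subrr.
Qed.

End Roots.

Lemma perrin_succ_prime (x y z : K) :
    x + y + z = 0 -> x * y + y * z + z * x = -1 -> x * y * z = 1 ->
    x ^+ p.+1 + y ^+ p.+1 + z ^+ p.+1 = 2%:R ->
  [/\ x ^+ p = x, y ^+ p = y & z ^+ p = z].
Proof.
move=> e1 e2 e3; have [xy yz zx] := perrin_roots_uniq e1 e2 e3.
have Frob := Frobenius_root e1 e2 e3.
have fx : [\/ x ^+ p = x, x ^+ p = y | x ^+ p = z].
  by apply: Frob; rewrite subrr !mul0r.
have fy : [\/ y ^+ p = x, y ^+ p = y | y ^+ p = z].
  by apply: Frob; rewrite subrr mulr0 mul0r.
have fz : [\/ z ^+ p = x, z ^+ p = y | z ^+ p = z].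
  by apply: Frob; rewrite subrr mulr0.
have nxy : x ^+ p <> y ^+ p by move/Frobenius_inj/eqP; rewrite (negbTE xy).
have nyz : y ^+ p <> z ^+ p by move/Frobenius_inj/eqP; rewrite (negbTE yz).
have nzx : z ^+ p <> x ^+ p by move/Frobenius_inj/eqP; rewrite (negbTE zx).
have cyc : x * y + y * z + z * x <> 2%:R.
  rewrite e2 => h; move/eqP: K3; apply.
  have -> : 3%:R = 2%:R - (- 1) :> K by ring.
  by rewrite h subrr.
have trx := perrin_transposition_neq e1 e2 e3.
have try : y ^+ 2 + 2%:R * z * x <> 2%:R.
  apply: perrin_transposition_neq; first by rewrite -e1; ring.
    by rewrite -[RHS]e2; ring.
  by rewrite -[RHS]e3; ring.
have trz : z ^+ 2 + 2%:R * x * y <> 2%:R.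
  apply: perrin_transposition_neq; first by rewrite -e1; ring.
    by rewrite -[RHS]e2; ring.
  by rewrite -[RHS]e3; ring.
rewrite !exprS.
(* Injectivity leaves six permutations: the identity is the claim, the two 3-cycles contradict
   [cyc], and the three transpositions contradict [trx], [try] and [trz]. *)
case: fx => fx; case: fy => fy; case: fz => fz;
  rewrite fx fy fz in nxy nyz nzx *; try by [];
  move=> h; exfalso;
  first [ apply: cyc; rewrite -[RHS]h; ring | apply: trx; rewrite -[RHS]h; ring
        | apply: try; rewrite -[RHS]h; ring | apply: trz; rewrite -[RHS]h; ring ].
Qed.

(** As x is fixed, Frobenius is the identity or swaps y and z. A swap would negate the product d of
    the differences, but d = t or - t is fixed. *)
Lemma perrin_prime_root_split (x t : K) :
    x ^+ p = x -> x ^+ 3 - x - 1 = 0 -> t ^+ p = t -> t ^+ 2 = - 23%:R ->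
    (perrin p.+1)%:R = 2%:R :> K.
Proof.
move=> xp xE tp t2; have [a [b [c [e1 e2 e3]]]] := perrin_roots K.
have [y [z [{}e1 {}e2 {}e3]]] : exists y z : K,
    [/\ x + y + z = 0, x * y + y * z + z * x = -1 & x * y * z = 1].
  move/eqP: xE; rewrite (perrin_root e1 e2 e3) !mulf_eq0 !subr_eq0.
  case/orP => [/orP[]|] /eqP->; [by exists b, c|exists c, a|exists a, b].
    by split; [rewrite -[RHS]e1|rewrite -[RHS]e2|rewrite -[RHS]e3]; ring.
  by split; [rewrite -[RHS]e1|rewrite -[RHS]e2|rewrite -[RHS]e3]; ring.
have [xy yz zx] := perrin_roots_uniq e1 e2 e3.
set d := (x - y) * (y - z) * (z - x).
have d2 : d ^+ 2 = - 23%:R := perrin_discriminant e1 e2 e3.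
have dp : d ^+ p = d.
  move/eqP: d2; rewrite -t2 eqf_sqr => /orP[] /eqP->; first exact: tp.
  have FrobN (u : K) : (- u) ^+ p = - u ^+ p.
    by rewrite -!(pFrobenius_autE pK) rmorphN.
  by rewrite FrobN tp.
have d0 : d != 0 by rewrite !mulf_neq0 // subr_eq0.
have FrobB (u v : K) : (u - v) ^+ p = u ^+ p - v ^+ p.
  by rewrite -!(pFrobenius_autE pK) rmorphB.
have fy : [\/ y ^+ p = x, y ^+ p = y | y ^+ p = z].
  by apply: (Frobenius_root e1 e2 e3); rewrite subrr mulr0 mul0r.
have fz : [\/ z ^+ p = x, z ^+ p = y | z ^+ p = z].
  by apply: (Frobenius_root e1 e2 e3); rewrite subrr mulr0.
have nxy : x ^+ p <> y ^+ p by move/Frobenius_inj/eqP; rewrite (negbTE xy).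
have nyz : y ^+ p <> z ^+ p by move/Frobenius_inj/eqP; rewrite (negbTE yz).
have nzx : z ^+ p <> x ^+ p by move/Frobenius_inj/eqP; rewrite (negbTE zx).
have sq : x ^+ 2 + y ^+ 2 + z ^+ 2 = 2%:R.
  have -> : x ^+ 2 + y ^+ 2 + z ^+ 2 =
    (x + y + z) ^+ 2 - 2%:R * (x * y + y * z + z * x) by ring.
  by rewrite e1 e2; ring.
rewrite (perrin_power_sum e1 e2 e3) !exprS.
case: fy => fy; case: fz => fz; rewrite xp fy fz in nxy nyz nzx *; try by [].
exfalso; move: dp; rewrite /d !exprMn !FrobB xp fy fz => dN.
have : 2%:R * d = 0.
  have -> : 2%:R * d = d - (x - z) * (z - y) * (y - x) by rewrite /d; ring.
  by rewrite dN subrr.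
by move/eqP; rewrite mulf_eq0 (negbTE K2) (negbTE d0).
Qed.

End PerrinPrime.

(** * Passage from Frobenius and reduced forms to the equivalences *)

Lemma perrin_prime_iff p (p_prime : prime p) :
    p != 2%N -> p != 3%N -> p != 23%N ->
  perrin p.+1 = 2 %[mod p] <->
  (exists t : 'F_p, t ^+ 2 = (-23)%:~R) /\ has_root p.
Proof.
move=> p2 p3 p23; have [K [f]] := exists_Fp_closure p.
have pK := pchar_closure f p_prime.
rewrite (natr_pchar_modn _ _ pK).
split=> [|[[t tE] /(has_rootP p_prime f)[x xp xE]]]; last first.
  apply: (perrin_prime_root_split p_prime p2 p23 f xp xE (t := f t)).
    by rewrite -rmorphXn Fp_Frobenius.
  by rewrite -rmorphXn tE rmorph_int.
have [x [y [z [e1 e2 e3]]]] := perrin_roots K.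
rewrite (perrin_power_sum e1 e2 e3).
case/(perrin_succ_prime p_prime p3 p23 f e1 e2 e3) => xp yp zp.
split; last first.
  apply/(has_rootP p_prime f); exists x => //.
  by rewrite (perrin_root e1 e2 e3) subrr !mul0r.
have FrobB (u v : K) : (u - v) ^+ p = u ^+ p - v ^+ p.
  by rewrite -!(pFrobenius_autE pK) rmorphB.
(* When Frobenius fixes all roots, the product of their differences, a square root of -23, lies in
   F_p. *)
have [t tE] : exists t, (x - y) * (y - z) * (z - x) = f t.
  by apply: fixed_by_Frobenius p_prime _; rewrite !exprMn !FrobB xp yp zp.
exists t; apply: (fmorph_inj f); rewrite rmorphXn -tE rmorph_int /=.
exact: perrin_discriminant.
Qed.

(** An odd square root b of -23 modulo p gives 4 p c = b^2 + 23, so the form (p, b, c) has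
    discriminant -23; it represents p at (1, 0) and can be reduced. *)
Lemma split_prime_form p : prime p -> p != 2%N ->
    (exists t : 'F_p, t ^+ 2 = (-23)%:~R) ->
  (exists X Y : int, p%:Z = X ^+ 2 + 23 * Y ^+ 2) \/
  (exists x y : int, p%:Z = 2 * x ^+ 2 + x * y + 3 * y ^+ 2).
Proof.
move=> p_prime p2 [t tE].
have p_odd : ~~ (2 %| p)%N by rewrite dvdn_prime2 // eq_sym.
have [b b_odd pb] : exists2 b : int, ~~ (2 %| b)%Z & (p %| b ^+ 2 + 23)%Z.
  have pt : (p %| (t : nat)%:Z ^+ 2 + 23)%Z.
    rewrite (dvdz_pcharf (pchar_Fp p_prime)) rmorphD rmorphXn /= -pmulrn natr_Zp.
    by rewrite tE rmorphN addNr.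
  have [t2|t2] := boolP (2 %| (t : nat)%:Z)%Z; last by exists (t : nat)%:Z.
  exists ((t : nat)%:Z + p%:Z); first by move: t2 p_odd; clear; lia.
  have -> : ((t : nat)%:Z + p%:Z) ^+ 2 + 23 =
    (t : nat)%:Z ^+ 2 + 23 + p%:Z * (2 * (t : nat)%:Z + p%:Z) by ring.
  by rewrite rpredD // dvdz_mulr.
have : (4 * p%:Z %| b ^+ 2 + 23)%Z.
  rewrite Gauss_dvdz ?pb ?andbT.
    have [d bE] : exists d, b = 2 * d + 1.
      by exists (b %/ 2)%Z; move: b_odd; clear; lia.
    by apply/dvdzP; exists (d ^+ 2 + d + 6); rewrite bE; ring.
  by rewrite coprimezE /= (coprime_pexpl (k := 2) 2) // prime_coprime.
case/dvdzP=> c bc.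
have disc : b ^+ 2 - 4 * p%:Z * c = - 23 by rewrite mulrC -bc; ring.
have p0 : 0 < p%:Z by rewrite ltz_nat prime_gt0.
have [rep|rep] := form_reduction p0 disc; have [x [y e]] := rep 1 0; last first.
  by right; exists x, y; move: e; clear; lia.
left; have {}e : p%:Z = x ^+ 2 + x * y + 6 * y ^+ 2 by move: e; clear; lia.
(* An odd y would make x (x + y), hence p, even. With y = 2 Y, completing the square gives (x + Y)^2
   + 23 Y^2. *)
have [Y [yE|yE]] : exists Y, y = 2 * Y \/ y = 2 * Y + 1.
  by exists (y %/ 2)%Z; clear; lia.
  by exists (x + Y), Y; rewrite e yE; ring.
have [X [xE|xE]] : exists X, x = 2 * X \/ x = 2 * X + 1.
    by exists (x %/ 2)%Z; clear; lia.
  by move: p_odd e; rewrite xE yE; clear; lia.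
by move: p_odd e; rewrite xE yE; clear; lia.
Qed.

Theorem corollary10 (p : nat) (p_prime : prime p)
    (p_ndvd : ~~ (p %| 2 * 3 * 23)%N) :
  let assertion1 := perrin p.+1 = 2 %[mod p] in
  let assertion2 := exists X Y : int, p%:Z = X ^+ 2 + 23 * Y ^+ 2 in
  let assertion3 := legendre (-23) p = 1 /\
                    exists x : 'F_p, x ^+ 3 - x - 1 = 0 in
  (assertion1 <-> assertion2) /\ (assertion2 <-> assertion3).
Proof.
have p2 : p != 2%N by apply: contraNneq p_ndvd => ->.
have p3 : p != 3%N by apply: contraNneq p_ndvd => ->.
have p23 : p != 23%N by apply: contraNneq p_ndvd => ->.
have pN23 : ~~ (p %| -23)%Z by rewrite dvdzE /= dvdn_prime2.
have leg := legendre_eq1 p_prime pN23.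
move=> a1 a2 a3; have a13 : a1 <-> a3.
  by rewrite /a1 /a3 leg; apply: perrin_prime_iff.
have a23 : a2 <-> a3; last by rewrite a13 a23.
rewrite /a2 /a3 leg; split=> [[X [Y pE]]|[sq root]].
  split; last exact: principal_form_root pE.
  have p1 : 1%N%:Z * p%:Z = X ^+ 2 + 23 * Y ^+ 2 by rewrite mul1r.
  have pn1 : ~~ (p %| 1)%N by rewrite dvdn1 gtn_eqF ?prime_gt1.
  have [K [f]] := exists_Fp_closure p.
  have [s [s2 sp _]] := ratio_sqrt p_prime f (form23_pndvdY p_prime pn1 p1) p1.
  have [t tE] := fixed_by_Frobenius f p_prime sp.
  by exists t; apply: (fmorph_inj f); rewrite rmorphXn -tE s2 rmorph_int.
(* As -23 is a square, one of the two forms represents p; the root modulo p excludes the second. *)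
have [//|[x [y pE]]] := split_prime_form p_prime p2 sq.
by case: (nonprincipal_form_root p_prime p2 p3 p23 pE).
Qed.
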